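(* Let $(X,Y)\sim P_{X,Y}$ with marginals $P_X,P_Y$, and suppose the triplet $(P_X,P_{Y|X},P_Y)$ satisfies the extended bounding condition with constant $\omega\ge 1$, i.e. $\max_{x,y} P_{Y|X}(y|x)/P_Y(y)\le\omega$. Let $K$ be the index selected by standard rejection sampling with target $P_{Y|X}(\cdot|x)$ given $X=x$, and let $R$ be the expected number of bits used to communicate $K$ by the Sorting Method (all defined in the context). Then $$R\le I(X;Y)+\log\big(I(X;Y)+1\big)+9 .$$
   Context: All logarithms are base 2; $I(X;Y)$ is the mutual information in bits. Distributions are identified with their densities (or mass functions) with respect to a common reference measure. Channel simulation: the encoder observes $X=x\sim P_X$; encoder and decoder share common randomness $W$ independent of $X$; the encoder sends a binary string $M$ to the decoder, which must output $Y\sim P_{Y|X}(\cdot|x)$. The coding cost is $R=\mathbb{E}[\ell(M)]$, the expected message length. Standard rejection sampling: $W=\{(U_1,Y_1),(U_2,Y_2),\dots\}$ with $U_i\sim\mathcal U(0,1)$ i.i.d., $Y_i\sim P_Y$ i.i.d., all independent. Given $X=x$, the encoder lets $K$ be the first index with $U_K\le \frac{P_{Y|X}(Y_K|x)}{\omega P_Y(Y_K)}$; then $Y_K\sim P_{Y|X}(\cdot|x)$. The constant $\omega$ is known to both parties. Sorting Method: $K$ is represented by two messages. (1) The group index $L=\lceil K/\lfloor\omega\rfloor\rceil$, so $(L-1)\lfloor\omega\rfloor+1\le K\le L\lfloor\omega\rfloor$. (2) The rank $\hat K\in\{1,\dots,\lfloor\omega\rfloor\}$ of $U_K$ when the values $U_i$,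 $(L-1)\lfloor\omega\rfloor+1\le i\le L\lfloor\omega\rfloor$, are sorted in increasing order. The decoder, which knows $W$, recovers $K$ from $(L,\hat K)$ and outputs $Y_K$. Entropy coding: $L$ and $\hat K$ are encoded separately, each positive-integer message $M'$ with a prefix-free code built from a Zipf distribution $q(m)\propto m^{-\lambda}$ on the positive integers with $\lambda=1+1/\mathbb{E}[\log M']$ (codeword lengths $\lceil-\log q(m)\rceil$; no bits are needed if $M'=1$ almost surely), the expectation being over both $X$ and $W$. $R$ is the total expected length of the two codewords. *)

(* Defs.v *)
From HB Require Import structures.
From mathcomp Require Import all_boot all_order all_algebra.
From mathcomp Require Import all_classical all_reals all_analysis.
Set Implicit Arguments.
Unset Strict Implicit.
Unset Printing Implicit Defensive.
Import Order.TTheory GRing.Theory Num.Theory.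
Import numFieldNormedType.Exports.
Local Open Scope classical_set_scope.
Local Open Scope ring_scope.

Definition log2 (R : realType) (x : R) : R := ln x / ln 2.

Definition is_density d (T : measurableType d) (R : realType)
    (mu : {measure set T -> \bar R}) (f : T -> R) : Prop :=
  [/\ measurable_fun setT f, forall x, 0 <= f x
    & (\int[mu]_x (f x)%:E = 1)%E].

Definition is_conditional_density dX dY (TX : measurableType dX)
    (TY : measurableType dY) (R : realType)
    (nu : {measure set TY -> \bar R}) (p : TX -> TY -> R) : Prop :=
  measurable_fun setT (fun z : TX * TY => p z.1 z.2)
  /\ forall x, is_density nu (p x).

Definition is_output_density dX dY (TX : measurableType dX)
    (TY : measurableType dY) (R : realType)
    (mu : {measure set TX -> \bar R}) (nu : {measure set TY -> \bar R})
    (pX : TX -> R) (pYX : TX -> TY -> R) (pY : TY -> R) : Prop :=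
  is_density nu pY
  /\ {ae nu, forall y, (\int[mu]_x (pX x * pYX x y)%:E = (pY y)%:E)%E}.

Definition has_law d d' (T : measurableType d) (T' : measurableType d')
    (R : realType) (P : probability T R) (mu : {measure set T' -> \bar R})
    (X : {RV P >-> T'}) (f : T' -> R) : Prop :=
  forall A, measurable A ->
    (distribution P X A = \int[mu]_(x in A) (f x)%:E)%E.

(* The ratio pYX x y / pY y is cross-multiplied, so that 0 / 0 is harmless and
   a positive number over 0 violates the bound; with the division of a
   fieldType the latter would count as 0. *)
Definition bounding_condition (TX TY : Type) (R : realType)
    (pYX : TX -> TY -> R) (pY : TY -> R) (omega : R) : Prop :=
  forall x y, pYX x y <= omega * pY y.

(* Since [ln 0 = 0] and [z / 0 = 0], the integrand vanishes wherever the joint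
   density does; where only pX x * pY y vanishes, it vanishes too, but that set
   is null for the joint law. *)
Definition mutual_information dX dY (TX : measurableType dX)
    (TY : measurableType dY) (R : realType)
    (mu : {sigma_finite_measure set TX -> \bar R})
    (nu : {sigma_finite_measure set TY -> \bar R})
    (pXY : TX -> TY -> R) (pX : TX -> R) (pY : TY -> R) : \bar R :=
  (\int[(mu \x nu)%E]_z
     (pXY z.1 z.2 * log2 (pXY z.1 z.2 / (pX z.1 * pY z.2)))%:E)%E.

Definition mutually_independent d (T : measurableType d) (R : realType)
    (P : probability T R) (I : eqType) (F : I -> set (set T)) : Prop :=
  forall (s : seq I) (E : I -> set T), uniq s ->
    (forall i, i \in s -> F i (E i)) ->
    (P (\bigcap_(i in [set` s]) E i) = \prod_(i <- s) P (E i))%E.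

(* The sigma-algebras generated by the source X ([None]) and by the entries
   U i ([Some (inl i)]) and Y i ([Some (inr i)]) of the common randomness. *)
Definition sampler_sigma d dX dY (T : measurableType d)
    (TX : measurableType dX) (TY : measurableType dY) (R : realType)
    (X : T -> TX) (U : nat -> T -> R) (Y : nat -> T -> TY)
    (i : option (nat + nat)) : set (set T) :=
  match i with
  | None => preimage_set_system setT X measurable
  | Some (inl k) => preimage_set_system setT (U k) measurable
  | Some (inr k) => preimage_set_system setT (Y k) measurable
  end.

(* Least natural number satisfying A, or 0 if there is none. *)
Definition first_index (A : pred nat) : nat :=
  if pselect (exists i, A i) is left ex then ex_minn ex else 0%N.

(* Candidates are numbered from 1: candidate k is (u k.-1, y k.-1).  The value
   when every candidate is rejected is irrelevant, as this has probability 0. *)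
Definition rejection_index (TX TY : Type) (R : realType)
    (pYX : TX -> TY -> R) (pY : TY -> R) (omega : R)
    (x : TX) (u : nat -> R) (y : nat -> TY) : nat :=
  (first_index (fun i => u i <= pYX x (y i) / (omega * pY (y i)))).+1.

Definition ceil_div (m n : nat) : nat := ((m + n.-1) %/ n)%N.

Definition group_index (n k : nat) : nat := ceil_div k n.

(* The u-values of the candidates (l-1)n+1, ..., ln. *)
Definition group_values (R : realType) (n l : nat) (u : nat -> R) : seq R :=
  [seq u i.-1 | i <- iota ((l.-1 * n).+1) n].

Definition group_rank (R : realType) (n k : nat) (u : nat -> R) : nat :=
  (index (u k.-1)
     (sort (fun a b : R => a <= b) (group_values n (group_index n k) u))).+1.

Definition zipf (R : realType) (lambda : R) (m : nat) : R :=
  m%:R `^ (- lambda)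
  / fine (\sum_(0 <= k <oo) ((k.+1%:R : R) `^ (- lambda))%:E)%E.

Definition codeword_length (R : realType) (lambda : R) (m : nat) : int :=
  Num.ceil (- log2 (zipf lambda m)).

(* When E[log M] is infinite there is no Zipf parameter, and the cost is set
   to +oo. *)
Definition coding_cost d (T : measurableType d) (R : realType)
    (P : probability T R) (M : T -> nat) : \bar R :=
  (if pselect {ae P, forall w, M w = 1%N} then 0
   else match 'E_P[fun w => log2 (M w)%:R] with
        | r%:E => 'E_P[fun w => (codeword_length (1 + r^-1) (M w))%:~R]
        | _ => +oo
        end)%E.

(* [Num.truncn omega] is the floor of omega, as omega is nonnegative. *)
Definition sorting_cost d dX dY (T : measurableType d)
    (TX : measurableType dX) (TY : measurableType dY) (R : realType)
    (P : probability T R)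
    (pYX : TX -> TY -> R) (pY : TY -> R) (omega : R)
    (X : T -> TX) (U : nat -> T -> R) (Y : nat -> T -> TY) : \bar R :=
  let n := Num.truncn omega in
  let K w := rejection_index pYX pY omega (X w) (U ^~ w) (Y ^~ w) in
  let L w := group_index n (K w) in
  let Khat w := group_rank n (K w) (U ^~ w) in
  (coding_cost P L + coding_cost P Khat)%E.

(* Main.v *)
Require Import Defs.
From HB Require Import structures.
From mathcomp Require Import all_boot all_order all_algebra.
From mathcomp Require Import all_classical all_reals all_analysis.
From mathcomp Require Import measurable_realfun.
From mathcomp Require Import ring lra.
Import Order.TTheory GRing.Theory Num.Theory.
Import numFieldNormedType.Exports.
Local Open Scope classical_set_scope.
Local Open Scope ring_scope.

(* A Zipf code of parameter [1 + 1/r], [r = E[log M]], spends at most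
   [r + log (r + 1) + 2] bits, because [zeta (1 + 1/r) <= 1 + r].
   The index [K] is geometric with ratio [q = 1 - 1/omega], and
   [q ^ floor omega <= 1/2], so [E[log L] <= E[L] - 1 <= 1].
   Write [rho] for [pYX / pY] at the selected pair.  A candidate [i <> K] of the
   group of [K] lies below [U_K] only if [U_i <= rho / omega]; dropping the
   rejection of [i] leaves an event independent of the other rejections, which
   yields [E[rank / rho] <= 2].  By concavity of [log],
   [E[log rank] <= E[log rho] + log E[rank / rho] <= I(X;Y) + 1].
   Both bounds combine to [4 + (I + 1) + log (I + 2) + 2 <= I + log (I + 1) + 8]. *)

Set Implicit Arguments.
Unset Strict Implicit.

(** * Cost of the Zipf code *)

(** Independence is given as a product formula for events, whereas the estimates integrate functions
    of many variables at once. A block of variables is therefore modelled as the sample space with a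
    smaller sigma-algebra, and [decoupling] integrates out one threshold or proposal while the rest
    is frozen. The sign of ln rho varies, so it is replaced by [log_deficit] = ln (omega / rho) >=
    0; most comparisons then concern nonnegative integrands and need no integrability. Zeros of the
    densities are absorbed by cross-multiplied inequalities and by the value of [rank_weight] at rho
    = 0. Concavity of the logarithm enters as its tangent at 2. That point is the bound on the
    weighted rank: the selected candidate contributes at most 1, and the others of its group at most
    (n - 1) (1 + omega) / omega^2 <= 1, where n = floor omega. *)

Section zipf_coding.
Context (R : realType).
Implicit Types (s r x y : R) (n m N : nat).

Lemma ln2_gt0 : 0 < ln 2 :> R.
Proof. by rewrite ln_gt0// ltr1n. Qed.

Lemma log2_ge0 x : 1 <= x -> 0 <= log2 x.
Proof. by move=> x1; apply: divr_ge0; [exact: ln_ge0|exact/ltW/ln2_gt0]. Qed.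

Lemma le_log2 x y : 0 < x -> x <= y -> log2 x <= log2 y.
Proof.
move=> x0 xy; rewrite ler_wpM2r ?invr_ge0 ?(ltW ln2_gt0)// ler_ln ?posrE//.
exact: lt_le_trans xy.
Qed.

Lemma log2M x y : 0 < x -> 0 < y -> log2 (x * y) = log2 x + log2 y.
Proof. by move=> x0 y0; rewrite /log2 lnM ?posrE// mulrDl. Qed.

Lemma log2_pow2 n : log2 (2 ^+ n) = n%:R :> R.
Proof. by rewrite /log2 lnXn// mulrnAl divff ?gt_eqF ?ln2_gt0. Qed.

Lemma log2_nat_le n : log2 n.+1%:R <= n%:R :> R.
Proof.
rewrite -[leRHS]log2_pow2; apply: le_log2; first by rewrite ltr0n.
by rewrite -natrX ler_nat ltn_expl.
Qed.

(* The right-hand side is the integral of [s * x `^ (- (1 + s))] over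
   [n.+1, n.+2]. *)
Lemma powR_telescope s n : 0 < s ->
  s * n.+2%:R `^ (- (1 + s)) <= n.+1%:R `^ (- s) - n.+2%:R `^ (- s).
Proof.
move=> s0; set a : R := n.+1%:R; set b : R := n.+2%:R.
have a0 : 0 < a by rewrite ltr0n.
have b0 : 0 < b by rewrite ltr0n.
have -> : b `^ (- (1 + s)) = b^-1 * b `^ (- s).
  rewrite opprD powRD; last by rewrite (gt_eqF b0) implybT.
  by rewrite powR_inv1 // ltW.
have -> : a `^ (- s) = (a / b) `^ (- s) * b `^ (- s).
  by rewrite -powRM ?divr_ge0 ?ltW// divfK ?gt_eqF.
(* After division by b^(-s) the claim is 1 + s/b <= (1 - 1/b)^(-s). It follows from exp y >= 1 + y
   and ln (1 - 1/b) <= - 1/b. *)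
rewrite mulrA -[X in _ <= _ - X]mul1r -mulrBl ler_wpM2r ?powR_ge0// lerBrDl.
rewrite /powR gt_eqF ?divr_gt0//; apply: le_trans (expR_ge1Dx _).
rewrite lerD2l mulNr -mulrN; apply: ler_wpM2l; first exact: ltW.
rewrite lerNr.
have -> : a / b = 1 + (- b^-1).
  have -> : a = b - 1 by rewrite /a /b -[n.+2]addn1 natrD addrK.
  by rewrite mulrBl divff ?(gt_eqF b0)// mul1r.
apply: le_ln1Dx; rewrite ltrN2 invf_lt1// ltr1n//.
Qed.

(** [powR_telescope] at s = 1/r, multiplied by r, telescopes. The subtracted remainder is what makes
    the induction close; [zeta_le] drops it. *)
Lemma zeta_partial_sum r n : 0 < r ->
  \sum_(0 <= k < n.+1) k.+1%:R `^ (- (1 + r^-1)) <= 1 + r - r * n.+1%:R `^ (- r^-1).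
Proof.
move=> r0; elim: n => [|n IH].
  by rewrite big_nat1 !powR1 mulr1 addrK.
rewrite big_nat_recr//=; apply: (le_trans (lerD IH (lexx _))).
have r1 : 0 < r^-1 by rewrite invr_gt0.
have := ler_wpM2l (ltW r0) (powR_telescope n r1).
rewrite mulrA divff ?gt_eqF// mul1r; lra.
Qed.

Definition zeta (lambda : R) : \bar R :=
  (\sum_(0 <= k <oo) (k.+1%:R `^ (- lambda))%:E)%E.

Lemma zeta_le r : 0 < r -> (zeta (1 + r^-1) <= (1 + r)%:E)%E.
Proof.
move=> r0; apply: lime_le.
  by apply: is_cvg_nneseries => n _ _; rewrite lee_fin powR_ge0.
apply: nearW => -[|n].
  by rewrite big_nil lee_fin addr_ge0// ltW.
rewrite sumEFin lee_fin (le_trans (zeta_partial_sum n r0))// lerBlDr lerDl.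
by rewrite mulr_ge0 ?powR_ge0// ltW.
Qed.

Lemma zeta_ge1 lambda : (1 <= zeta lambda)%E.
Proof.
apply: le_trans (nneseries_lim_ge 1 _).
  by rewrite big_nat1 powR1.
by move=> n _ _; rewrite lee_fin powR_ge0.
Qed.

Lemma zeta_fin_num r : 0 < r -> zeta (1 + r^-1) \is a fin_num.
Proof.
move=> r0; rewrite ge0_fin_numE; last exact: le_trans (zeta_ge1 _).
by rewrite (le_lt_trans (zeta_le r0))// ltry.
Qed.

Lemma log2_zipf r m : 0 < r ->
  - log2 (zipf (1 + r^-1) m.+1) =
  log2 (fine (zeta (1 + r^-1))) + (1 + r^-1) * log2 m.+1%:R.
Proof.
move=> r0; have z1 : 1 <= fine (zeta (1 + r^-1)).
  by rewrite -lee_fin fineK ?zeta_ge1// zeta_fin_num.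
rewrite /zipf -/(zeta _) /log2 ln_div ?posrE ?powR_gt0 ?ltr0n//; last first.
  exact: lt_le_trans z1.
rewrite ln_powR; field.
by rewrite ?gt_eqF ?ln2_gt0.
Qed.

(** The upper bound adds the normalizer, the power and the rounding up. Nonnegativity comes from
    zeta >= 1 and allows expectations to be compared without integrability. *)
Lemma codeword_length_itv r m : 0 < r ->
  0 <= ((codeword_length (1 + r^-1) m.+1)%:~R : R) <=
  log2 (1 + r) + (1 + r^-1) * log2 m.+1%:R + 1.
Proof.
move=> r0; have z1 : 1 <= fine (zeta (1 + r^-1)).
  by rewrite -lee_fin fineK ?zeta_ge1// zeta_fin_num.
rewrite /codeword_length log2_zipf//.
set y := _ + _ * _.
have y0 : 0 <= y.
  rewrite addr_ge0 ?log2_ge0// mulr_ge0 ?log2_ge0 ?ler1n// addr_ge0// invr_ge0 ltW//.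
have zr : log2 (fine (zeta (1 + r^-1))) <= log2 (1 + r).
  apply: le_log2; first exact: lt_le_trans z1.
  by rewrite -lee_fin fineK ?zeta_le// zeta_fin_num.
apply/andP; split; first by rewrite ler0z Num.Theory.ceil_ge0 (lt_le_trans _ y0).
have /andP[+ _] := Num.Theory.ceil_itv y; rewrite intrD/= /y => h; lra.
Qed.

End zipf_coding.

(** At the exact mean u = E[log M], averaging [codeword_length_itv] gives log (1 + u) + (1 + 1/u) u
    + 1 = u + log (u + 1) + 2. This increases with u, so an upper bound [r] on the mean suffices. *)
Lemma coding_cost_le d (T : measurableType d) (R : realType)
    (P : probability T R) (M : T -> nat) (r : R) :
  measurable_fun setT M -> (forall w, 0 < M w)%N -> 0 <= r ->
  (\int[P]_w (log2 (M w)%:R)%:E <= r%:E)%E ->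
  (coding_cost P M <= (r + log2 (r + 1) + 2)%:E)%E.
Proof.
move=> mM M0 r0 Mr; rewrite /coding_cost; case: (pselect {ae P, forall w, M w = 1%N}) => [one|notone] /=.
  by rewrite lee_fin !addr_ge0// log2_ge0// lerDr.
have lM w : 0 <= log2 (M w)%:R :> R by rewrite log2_ge0// ler1n.
have mf (f : nat -> R) : measurable_fun setT (fun w => (f (M w))%:E).
  by apply/measurable_EFinP; exact: (measurableT_comp (f := f)).
rewrite unlock.
set t : \bar R := (\int[P]_w _)%E.
have t0 : (0 <= t)%E by apply: integral_ge0 => w _; rewrite lee_fin.
have tfin : t \is a fin_num by rewrite ge0_fin_numE// (le_lt_trans Mr)// ltry.
(* A zero mean would force log M = 0, hence M = 1, almost surely: the case already excluded. So 1/u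
   is a genuine inverse. *)
have tpos : t != 0%E.
  apply: contra_notN notone => /eqP t_eq0.
  have [/(_ _)/= + _] := ae_eq_integral_abs P measurableT (mf (fun m => log2 m%:R)).
  rewrite (eq_integral (fun w => (log2 (M w)%:R)%:E)); last first.
    by move=> w _; rewrite /= ger0_norm.
  move=> /(_ t_eq0); apply: filterS => w /(_ I) [] /=.
  have := M0 w; case: (M w) => // -[//|m] _ /eqP.
  rewrite gt_eqF// divr_gt0 ?ln2_gt0//.
  by apply: ln_gt0; rewrite ltr1n.
rewrite -(fineK tfin); set u := fine t.
have u0 : 0 < u by rewrite fine_gt0// lt0e tpos t0 -ge0_fin_numE.
have ur : u <= r by rewrite -lee_fin fineK.
apply: (@le_trans _ _ (\int[P]_w (log2 (1 + u) + (1 + u^-1) * log2 (M w)%:R + 1)%:E)%E).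
  apply: ge0_le_integral => //.
  - move=> w _; rewrite lee_fin; have := M0 w; case: (M w) => // m _.
    by have /andP[] := codeword_length_itv m u0.
  - exact: (mf (fun m => (codeword_length (1 + u^-1) m)%:~R)).
  - exact: (mf (fun m => log2 (1 + u) + (1 + u^-1) * log2 m%:R + 1)).
  - move=> w _; rewrite lee_fin; have := M0 w; case: (M w) => // m _.
    by have /andP[] := codeword_length_itv m u0.
have c0 : 0 <= log2 (1 + u) + 1 by rewrite addr_ge0// log2_ge0// lerDl ltW.
have v0 : 0 <= 1 + u^-1 by rewrite addr_ge0// invr_ge0 ltW.
rewrite (eq_integral (fun w => (log2 (1 + u) + 1)%:E + (1 + u^-1)%:E * (log2 (M w)%:R)%:E)%E); last first.
  by move=> w _; rewrite -EFinM -EFinD addrAC.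
rewrite ge0_integralD//=; first last.
- by apply: emeasurable_funM => //; exact: (mf (fun m => log2 m%:R)).
- by move=> w _; rewrite mule_ge0 ?lee_fin.
rewrite integral_cst//= probability_setT mule1 ge0_integralZl//; first last.
- by move=> w _; rewrite lee_fin.
- exact: (mf (fun m => log2 m%:R)).
rewrite -/t -(fineK tfin) -/u -EFinM -EFinD lee_fin.
have : log2 (1 + u) <= log2 (r + 1).
  by apply: le_log2; rewrite ?addr_gt0// addrC lerD2r.
rewrite mulrDl mulVf ?gt_eqF// mul1r; lra.
Qed.

(** * Geometric series and random indices *)

Lemma nneseries_geometric (R : realType) (c q : R) : 0 <= q < 1 ->
  (\sum_(0 <= k <oo) (c * q ^+ k)%:E = (c / (1 - q))%:E)%E.
Proof.
move=> /andP[q0 q1]; apply/cvg_lim => //; apply: cvg_EFin.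
  by apply: nearW => n; rewrite sumEFin.
rewrite [X in X @ _ --> _](_ : _ = series (geometric c q)); last first.
  by apply/funext => n; rewrite /= sumEFin.
by apply: cvg_geometric_series; rewrite ger0_norm.
Qed.

(** Since [0.-1 = 0], the first term of the geometric series is counted twice. The exponent [k.-1]
    stems from the rejection dropped in [integral_rank_term]. *)
Lemma nneseries_geometric_pred (R : realType) (c q : R) : 0 <= c -> 0 <= q < 1 ->
  (\sum_(0 <= k <oo) (c * q ^+ k.-1)%:E = (c + c / (1 - q))%:E)%E.
Proof.
move=> c0 q01; have /andP[q0 q1] := q01.
have f0 k : (0 <= (c * q ^+ k.-1)%:E)%E by rewrite lee_fin mulr_ge0 ?exprn_ge0.
rewrite nneseries_recl// -(nneseries_addn 1 f0) expr0 mulr1 EFinD; congr (_ + _)%E.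
rewrite -nneseries_geometric//.
by apply: eq_eseriesr => k _; rewrite addn1.
Qed.

(** Resolving a random index into a series of indicators reduces measurability and integration of
    [f (N w) w] to each single [f k]. *)
Lemma nneseries_select (R : realType) (f : nat -> \bar R) (N : nat) :
  (forall k, 0 <= f k)%E ->
  (f N = \sum_(0 <= k <oo) f k * (N == k)%:R%:E)%E.
Proof.
move=> f0; rewrite (nneseriesD1 (n := N))//; last first.
  by move=> k _; rewrite mule_ge0 ?lee_fin.
rewrite eqxx mule1 eseries0 ?adde0// => k _ /= /negPf kN.
by rewrite eq_sym kN mule0.
Qed.

Lemma measurable_nat_eq d (T : measurableType d) (N : T -> nat) k :
  measurable_fun setT N -> measurable_fun setT (fun w => N w == k).
Proof. exact: (measurableT_comp (f := fun n => n == k)). Qed.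

Section random_index.
Context d (T : measurableType d) (R : realType) (P : {measure set T -> \bar R}).
Variables (N : T -> nat) (f : nat -> T -> \bar R).
Hypotheses (mN : measurable_fun setT N) (f0 : forall k w, (0 <= f k w)%E)
  (mf : forall k, measurable_fun setT (f k)).

Let term_ge0 k w : (0 <= f k w * (N w == k)%:R%:E)%E.
Proof. by rewrite mule_ge0 ?lee_fin. Qed.

Let measurable_term k : measurable_fun setT (fun w => f k w * (N w == k)%:R%:E)%E.
Proof.
apply: emeasurable_funM => //; apply/measurable_EFinP.
apply: (measurableT_comp (f := fun b : bool => b%:R : R)) => //.
exact: measurable_nat_eq.
Qed.

Lemma measurable_random_index : measurable_fun setT (fun w => f (N w) w).
Proof.
rewrite (_ : (fun w => _) = fun w => (\sum_(0 <= k <oo) f k w * (N w == k)%:R%:E)%E).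
  exact: ge0_emeasurable_sum.
by apply/funext => w; exact: (nneseries_select (f := f ^~ w)).
Qed.

Lemma integral_random_index :
  (\int[P]_w f (N w) w = \sum_(0 <= k <oo) \int[P]_w (f k w * (N w == k)%:R%:E))%E.
Proof.
rewrite -integral_nneseries//.
by apply: eq_integral => w _; exact: (nneseries_select (f := f ^~ w)).
Qed.

End random_index.

(** * Arithmetic of groups and ranks *)

Lemma bernoulli_ineq (R : realDomainType) (x : R) n : 0 <= x ->
  1 + n%:R * x <= (1 + x) ^+ n.
Proof.
move=> x0; elim: n => [|n IH]; first by rewrite mul0r addr0 expr0.
rewrite exprS (le_trans _ (ler_wpM2l _ IH)) ?addr_ge0// -natr1.
have : 0 <= n%:R * x * x by rewrite !mulr_ge0.
lra.
Qed.

(** With n = floor omega, omega < n + 1 gives 1 - 1/omega <= 1 / (1 + 1/n), and (1 + 1/n)^n >= 2 by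
    Bernoulli's inequality. *)
Lemma rejection_pow_le_half (R : realType) (omega : R) :
  1 <= omega -> (1 - omega^-1) ^+ Num.truncn omega <= 2^-1.
Proof.
move=> omega1; set n := Num.truncn omega.
have omega0 : 0 < omega by exact: lt_le_trans omega1.
have n1 : (0 < n)%N by rewrite truncn_gt0.
have n0 : 0 < n%:R :> R by rewrite ltr0n.
have omega_n : omega < n%:R + 1 by rewrite natr1 truncnS_gt.
have q_le : 1 - omega^-1 <= (1 + n%:R^-1)^-1.
  rewrite (_ : (1 + n%:R^-1)^-1 = 1 - (n%:R + 1)^-1); last first.
    by field; rewrite !gt_eqF// addr_gt0.
  by rewrite lerD2l lerN2 lef_pV2 ?posrE ?addr_gt0// ltW.
have q0 : 0 <= 1 - omega^-1 by rewrite subr_ge0 invf_le1.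
apply: (le_trans (lerXn2r n _ _ q_le)); rewrite ?nnegrE// ?invr_ge0 ?addr_ge0 ?invr_ge0//.
rewrite exprVn lef_pV2 ?posrE ?exprn_gt0 ?addr_gt0 ?invr_gt0//.
apply: le_trans (bernoulli_ineq n _); last by rewrite invr_ge0.
by rewrite divff ?gt_eqF.
Qed.

(** Candidates are numbered from 1 in the definitions and from 0 in the proof; the shift turns the
    ceiling into a floor. *)
Lemma group_indexS n k : (0 < n)%N -> group_index n k.+1 = (k %/ n).+1.
Proof.
move=> n0; rewrite /group_index /ceil_div -{1}[k.+1]addn1 -addnA add1n prednK//.
by rewrite divnDr ?dvdnn// divnn n0 addn1.
Qed.

Lemma measurable_natr d (T : measurableType d) (R : realType) (N : T -> nat) :
  measurable_fun setT (fun w => (N w)%:R : R) -> measurable_fun setT N.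
Proof.
move=> mN _ B _; rewrite setTI.
rewrite (_ : _ @^-1` _ = \bigcup_(k in B) ((fun w => (N w)%:R : R) @^-1` [set k%:R])).
  apply: bigcup_measurable => k _; rewrite -[X in measurable X]setTI.
  exact: mN.
rewrite predeqE => w; split => [BN|[k Bk /= /eqP]]; first by exists (N w).
by rewrite eqr_nat => /eqP ->.
Qed.

(** [index] returns the first occurrence, so only strictly smaller values precede it. Ties between
    thresholds therefore need no separate treatment. *)
Lemma index_sorted_count (R : realDomainType) (s : seq R) (x : R) :
  sorted (fun a b : R => (a <= b)%R) s -> x \in s ->
  index x s = count (fun a => a < x)%R s.
Proof.
have tr : transitive (fun a b : R => (a <= b)%R) by exact: le_trans.
elim: s => // a s IH /= pas; have /allP sa := order_path_min tr pas.
rewrite inE; case: (eqVneq a x) => //= ax xs.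
  apply/esym/eqP; rewrite -ax ltxx -leqn0 leqNgt -has_count; apply/hasPn => b bs.
  by rewrite -leNgt sa.
rewrite lt_neqAle ax sa// add1n; congr _.+1.
by apply: IH => //; exact: path_sorted pas.
Qed.

(** As a sum of one indicator per competitor in the group, the rank can be integrated term by
    term. *)
Lemma group_rankE (R : realType) n k (u : nat -> R) : (0 < n)%N ->
  ((group_rank n k.+1 u)%:R : R) =
  1 + \sum_(i <- iota (k %/ n * n) n | i != k) (u i < u k)%R%:R.
Proof.
move=> n0; rewrite /group_rank group_indexS//= -natr1 addrC; congr (_ + _).
have group_valuesE : group_values n (k %/ n).+1 u = [seq u i | i <- iota (k %/ n * n) n].
  by rewrite /group_values/= -[X in iota X _]add1n iotaDl -map_comp.
set t := sort _ _.
have perm_t : perm_eq t (group_values n (k %/ n).+1 u) by rewrite perm_sort.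
have uk : u k \in t.
  rewrite (perm_mem perm_t) group_valuesE map_f// mem_iota leq_divM/=.
  by rewrite {1}(divn_eq k n) ltn_add2l ltn_mod.
rewrite index_sorted_count//; last by apply: sort_sorted => a b; exact: le_total.
rewrite (permP perm_t) group_valuesE count_map -sum1_count big_mkcond/= natr_sum.
rewrite [RHS]big_mkcond/=; apply: eq_bigr => i _.
have [->|_] /= := eqVneq i k; first by rewrite ltxx.
by case: (u i < u k).
Qed.

(** * Independence of blocks of sigma-algebras *)

Section independent_blocks.
Context d (T : measurableType d) (R : realType) (P : probability T R).
Context (I : eqType) (F : I -> set (set T)).
Hypothesis F_measurable : forall i, F i `<=` measurable.
Hypothesis F_setT : forall i, F i setT.
Hypothesis F_setI : forall i, setI_closed (F i).
Hypothesis F_indep : mutually_independent P F.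

Definition block_events (J : pred I) : set (set T) :=
  \bigcup_(i in [set i | J i]) F i.

(** Unlike [block_events], these finite intersections form a pi-system, and mutual independence
    applies to them directly. *)
Definition cylinders (J : pred I) : set (set T) :=
  [set A | exists s (E : I -> set T),
     [/\ uniq s, forall i, i \in s -> J i /\ F i (E i)
       & A = \bigcap_(i in [set` s]) E i]].

Lemma cylindersT J : cylinders J setT.
Proof.
exists [::], (fun=> setT); split => //.
by rewrite predeqE => x; split.
Qed.

Lemma setI_closed_cylinders J : setI_closed (cylinders J).
Proof.
move=> _ _ [s1 [E1 [us1 H1 ->]]] [s2 [E2 [us2 H2 ->]]].
(* An index that occurs in one list only is intersected with [setT]; an index common to both is
   merged by [F_setI]. *)
exists (undup (s1 ++ s2)), (fun i =>
  (if i \in s1 then E1 i else setT) `&` (if i \in s2 then E2 i else setT)).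
split; first exact: undup_uniq.
- move=> i; rewrite mem_undup mem_cat => si; split.
    by case/orP: si => [/H1[]|/H2[]].
  by apply: F_setI; [case: ifPn => // /H1[]|case: ifPn => // /H2[]].
- rewrite predeqE => x; split.
  + by move=> [h1 h2] i _; split; case: ifPn => // ?; by [apply: h1|apply: h2].
  + by move=> h; split=> i /= si; have := h i;
      rewrite /= mem_undup mem_cat si ?orbT => /(_ isT)[].
Qed.

Lemma measurable_cylinders J : cylinders J `<=` measurable.
Proof.
move=> _ [s [E [us H ->]]]; apply: fin_bigcap_measurable => // i /= /H[_].
exact: F_measurable.
Qed.

Lemma block_events_cylinders J : <<s block_events J >> `<=` <<s cylinders J >>.
Proof.
apply: sub_smallest2r; first exact: smallest_sigma_algebra.
move=> A [i /= Ji FA].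
exists [:: i], (fun=> A); split => //.
  by move=> j; rewrite inE => /eqP ->.
rewrite predeqE => x; split => [Ax j //|]; apply.
by rewrite /= inE.
Qed.

Lemma measurable_block J : <<s block_events J >> `<=` measurable.
Proof.
apply: smallest_sub; first exact: sigma_algebra_measurable.
by move=> A [i _]; exact: F_measurable.
Qed.

Lemma cylinders_indep (J1 J2 : pred I) A B : (forall i, J1 i -> ~~ J2 i) ->
  cylinders J1 A -> cylinders J2 B -> (P (A `&` B) = P A * P B)%E.
Proof.
move=> J12 [s1 [E1 [us1 H1 ->]]] [s2 [E2 [us2 H2 ->]]].
have s12 i : i \in s2 -> i \notin s1.
  by move=> /H2[J2i _]; apply/negP => /H1[/J12]; rewrite J2i.
have -> : \bigcap_(i in [set` s1]) E1 i `&` \bigcap_(i in [set` s2]) E2 i =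
    \bigcap_(i in [set` s1 ++ s2]) (if i \in s1 then E1 i else E2 i).
  rewrite predeqE => x; split.
  + move=> [h1 h2] i /=; rewrite mem_cat => /orP[|] si.
      by rewrite si; exact: h1.
    by rewrite (negbTE (s12 _ si)); exact: h2.
  + move=> h; split => i /= si; have := h i; rewrite /= mem_cat si ?orbT.
    * by apply.
    * by rewrite (negbTE (s12 _ si)); apply.
rewrite F_indep; first last.
- move=> i; rewrite mem_cat => /orP[|] si.
    by rewrite si; have [] := H1 i si.
  by rewrite (negbTE (s12 _ si)); have [] := H2 i si.
- rewrite cat_uniq us1 us2 andbT; apply/hasPn => i /=; exact: s12.
rewrite big_cat/= !F_indep //; first last.
- by move=> i /H1[].
- by move=> i /H2[].
congr (_ * _)%E; apply: eq_big_seq => i si; first by rewrite si.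
by rewrite (negbTE (s12 _ si)).
Qed.

(** For fixed [B], both sides are finite measures in [A]: the restriction of [P] to [B] and [P]
    scaled by [P B]. Agreement on a pi-system containing the whole space extends to the generated
    sigma-algebra. *)
Lemma indep_generated (G : set (set T)) (B : set T) : setI_closed G ->
  G `<=` measurable -> G setT -> measurable B ->
  (forall A, G A -> P (A `&` B) = P A * P B)%E ->
  forall A, <<s G >> A -> (P (A `&` B) = P A * P B)%E.
Proof.
move=> GI Gm GT mB GB A sA.
have PB0 : 0 <= fine (P B) by rewrite fine_ge0// measure_ge0.
have PBfin : P B \is a fin_num by exact: fin_num_measure.
pose m1 : {measure set T -> \bar R} := mrestr P mB.
pose m2 : {measure set T -> \bar R} := mscale (NngNum PB0) P.
have := @g_sigma_algebra_measure_unique _ R T G Gm (fun=> setT) (fun=> GT) _ m1 m2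
  GI _ _ A sA.
rewrite /m1 /m2 /= /mrestr /mscale /= fineK// muleC => -> //.
- by rewrite bigcup_const//; exists 0%N.
- by move=> A0 /GB; rewrite muleC.
- by move=> _; rewrite setTI ltey_eq PBfin.
Qed.

(** [cylinders_indep] is extended by [indep_generated] in each of the two arguments, the other one
    being held fixed. *)
Lemma blocks_indep (J1 J2 : pred I) A B : (forall i, J1 i -> ~~ J2 i) ->
  <<s block_events J1 >> A -> <<s block_events J2 >> B ->
  (P (A `&` B) = P A * P B)%E.
Proof.
move=> J12 sA sB.
apply: (@indep_generated (cylinders J1)).
- exact: setI_closed_cylinders.
- exact: measurable_cylinders.
- exact: cylindersT.
- exact: (measurable_block sB).
- move=> A0 cA0; rewrite setIC muleC.
  apply: (@indep_generated (cylinders J2)).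
  + exact: setI_closed_cylinders.
  + exact: measurable_cylinders.
  + exact: cylindersT.
  + exact: (measurable_cylinders cA0).
  + by move=> B0 cB0; rewrite setIC muleC; apply: (@cylinders_indep J1 J2).
  + exact: block_events_cylinders.
- exact: block_events_cylinders.
Qed.

(** The sample space itself, with a smaller sigma-algebra: measurability on [block J] expresses that
    a function is determined by the variables in [J]. *)
Local Notation block J := (g_sigma_algebraType (block_events J)).

Lemma block_measurable d' (T' : measurableType d') (J : pred I) (f : T -> T') :
  (forall A, measurable A -> exists2 i, J i & F i (f @^-1` A)) ->
  measurable_fun setT (f : block J -> T').
Proof.
move=> fF _ A mA; rewrite setTI; have [i Ji FA] := fF A mA.
by apply: sub_sigma_algebra; exists i.
Qed.

Lemma block_measurableW d' (T' : measurableType d') (J1 J2 : pred I) (f : T -> T') :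
  (forall i, J1 i -> J2 i) -> measurable_fun setT (f : block J1 -> T') ->
  measurable_fun setT (f : block J2 -> T').
Proof.
move=> J12 mf _ A mA; rewrite setTI.
have := mf measurableT A mA; rewrite setTI.
apply: sub_smallest2r; first exact: smallest_sigma_algebra.
by move=> B [i /= /J12 J2i FB]; exists i.
Qed.

Lemma block_measurable_fun d' (T' : measurableType d') (J : pred I) (f : T -> T') :
  measurable_fun setT (f : block J -> T') -> measurable_fun setT f.
Proof.
move=> mf _ A mA; have := mf measurableT A mA.
by rewrite !setTI; exact: measurable_block.
Qed.

Definition to_block (J : pred I) (x : T) : block J := x.

Lemma measurable_to_block J : measurable_fun setT (to_block J).
Proof.
by move=> _ A mA; rewrite setTI; exact: (measurable_block mA).
Qed.

(* The diagonal map sends [P] to the product of its restrictions to the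
   sigma-algebras of two disjoint blocks. *)
Lemma decoupling (J1 J2 : pred I) (f : block J1 * block J2 -> \bar R) :
  (forall i, J1 i -> ~~ J2 i) ->
  measurable_fun setT f -> (forall z, 0 <= f z)%E ->
  (\int[P]_x f (x, x) = \int[P]_x \int[P]_y f (x, y))%E.
Proof.
move=> J12 mf f0.
pose P1 : probability (block J1) R := distribution P
  (HB.pack (to_block J1) (isMeasurableFun.Build _ _ _ _ _ (@measurable_to_block J1))).
pose P2 : probability (block J2) R := distribution P
  (HB.pack (to_block J2) (isMeasurableFun.Build _ _ _ _ _ (@measurable_to_block J2))).
pose dg (x : T) : block J1 * block J2 := (to_block J1 x, to_block J2 x).
have mdg : measurable_fun setT dg.
  by apply/measurable_fun_pair; exact: measurable_to_block.
(* The diagonal pulls the rectangle A x B back to the intersection of A and B, so [blocks_indep]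
   gives the rectangles and uniqueness of the product measure the rest. *)
have E : forall X, measurable X -> (P1 \x P2)%E X = pushforward P dg X.
  apply: product_measure_unique => A B mA mB.
  by rewrite /pushforward/= /pushforward /= -(@blocks_indep J1 J2 A B).
have -> : (\int[P]_x f (x, x) = \int[pushforward P dg]_z f z)%E.
  by rewrite ge0_integral_pushforward.
rewrite -(eq_measure_integral _ (fun X mX _ => E X mX)) //.
rewrite fubini_tonelli1//= ge0_integral_pushforward//; last first.
- by move=> x _; apply: integral_ge0.
- exact: measurable_fun_fubini_tonelli_F.
apply: eq_integral => x _ /=.
rewrite /fubini_F ge0_integral_pushforward//=; first exact: measurable_to_block.
exact: measurableT_comp.
Qed.

End independent_blocks.

(** * Laws and densities *)

Lemma ln_le_subr1 (R : realType) (x : R) : 0 < x -> ln x <= x - 1.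
Proof.
move=> x0; have -> : x = 1 + (x - 1) by rewrite addrCA subrr addr0.
by rewrite [X in _ <= X - 1]addrC addrK; apply: le_ln1Dx; rewrite ltrBrDr addNr.
Qed.

Lemma measurable_natr_bool d (T : measurableType d) (R : realType) (b : T -> bool) :
  measurable_fun setT b -> measurable_fun setT (fun x => ((b x)%:R : R)%:E).
Proof.
move=> mb; apply/measurable_EFinP.
exact: (measurableT_comp (f := fun b : bool => b%:R : R)).
Qed.

Lemma integral_natr_bool d (T : measurableType d) (R : realType)
    (P : {measure set T -> \bar R}) (b : T -> bool) :
  measurable_fun setT b -> (\int[P]_w ((b w)%:R : R)%:E = P [set w | b w])%E.
Proof.
move=> mb.
have mB : measurable [set w | b w].
  by rewrite -[X in measurable X]setTI; exact: (mb measurableT [set true]).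
rewrite -[X in P X]setIT -integral_indic//; apply: eq_integral => w _.
by rewrite indicE; case: (boolP (b w)) => bw; [rewrite mem_set|rewrite memNset//; apply/negP].
Qed.

Lemma uniform_prob_le (R : realType) (t : R) : 0 <= t <= 1 ->
  (uniform_prob (@ltr01 R) `]-oo, t] = t%:E)%E.
Proof.
move=> /andP[t0 t1]; rewrite /uniform_prob integral_uniform_pdf.
have -> : `]-oo, t] `&` `[0, 1] = [set` `[0, t]] :> set R.
  by rewrite predeqE => x /=; rewrite !in_itv/=; split => [[? /andP[]]|/andP[]];
    [move=> -> //|move=> -> xt; rewrite xt (le_trans xt)].
rewrite (eq_integral (fun=> 1%E)); last first.
  move=> x; rewrite inE/= in_itv/= /uniform_pdf => /andP[x0 xt].
  by rewrite x0 (le_trans xt)// subr0 invr1.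
rewrite integral_cst//= lebesgue_measure_itv/= lte_fin.
by case: ltgtP t0 => // [t0|<-] _; rewrite ?mule0// sube0 mul1e.
Qed.

(** The identity 1/x = x (x^2)^(-1) passes to a nonnegative base, where the real power is the
    inverse; at 0 both sides are 0. *)
Lemma measurable_invr (R : realType) : measurable_fun setT (@GRing.inv R).
Proof.
rewrite (_ : GRing.inv = fun x : R => x * (x ^+ 2) `^ (-1)); last first.
  apply/funext => x; rewrite powR_inv1 ?sqr_ge0//.
  by have [->|x0] := eqVneq x 0; rewrite ?invr0 ?mul0r// expr2 invfM mulVKf.
apply: measurable_funM => //.
have m1 : measurable_fun setT (fun x : R => x `^ (-1)) by exact: measurable_powR.
have m2 : measurable_fun setT (fun x : R => x ^+ 2) by exact: measurable_funX.
exact: (measurableT_comp m1 m2).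
Qed.

Lemma integrable_density d (T : measurableType d) (R : realType)
    (m : {measure set T -> \bar R}) (p : T -> R) :
  is_density m p -> m.-integrable setT (EFin \o p).
Proof.
move=> [mp p0 p1]; apply/integrableP; split; first exact/measurable_EFinP.
under eq_integral => x _ do rewrite /= ger0_norm//.
by rewrite p1 ltry.
Qed.

(** The law of [V] is dominated by [nu]. Its Radon-Nikodym derivative has the same integral as [p]
    on every measurable set, hence equals [p] almost everywhere, and a change of variables
    concludes. *)
Lemma integral_has_law d d' (T : measurableType d) (T' : measurableType d')
    (R : realType) (P : probability T R) (nu : {sigma_finite_measure set T' -> \bar R})
    (V : {RV P >-> T'}) (p : T' -> R) (f : T' -> \bar R) :
  is_density nu p -> has_law nu V p -> measurable_fun setT f ->
  (forall y, 0 <= f y)%E ->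
  (\int[P]_w f (V w) = \int[nu]_y (f y * (p y)%:E))%E.
Proof.
move=> dp lawV mf f0; have [mp p0 p1] := dp.
have dom : distribution P V `<< nu.
  apply/null_content_dominatesP => A mA nuA0.
  rewrite lawV//; apply: null_set_integral => //.
  by apply/measurable_EFinP; exact: measurable_funS mp.
have -> : (\int[P]_w f (V w) = \int[distribution P V]_y f y)%E.
  by rewrite ge0_integral_pushforward.
rewrite -(Radon_Nikodym_SigmaFinite.change_of_variables dom)//.
have mfRN := measurable_int _ (Radon_Nikodym_SigmaFinite.f_integrable dom).
apply: ae_eq_integral => //.
- exact: emeasurable_funM.
- by apply: emeasurable_funM => //; exact/measurable_EFinP.
apply: ae_eqe_mul2l.
apply: integral_ae_eq => //.
- exact: Radon_Nikodym_SigmaFinite.f_integrable.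
- exact/measurable_EFinP.
- by move=> E _ mE; rewrite -(lawV _ mE) -Radon_Nikodym_SigmaFinite.f_integral.
Qed.

(** * Rejection sampling and the sorting method *)

Section sampler.
Context (R : realType) (d dX dY : measure_display)
    (Omega : measurableType d) (TX : measurableType dX)
    (TY : measurableType dY) (P : probability Omega R)
    (mu : {sigma_finite_measure set TX -> \bar R})
    (nu : {sigma_finite_measure set TY -> \bar R})
    (pX : TX -> R) (pYX : TX -> TY -> R) (pY : TY -> R) (omega : R)
    (X : {RV P >-> TX}) (U : nat -> {RV P >-> R}) (Y : nat -> {RV P >-> TY})
    (pX_density : is_density mu pX)
    (pYX_density : is_conditional_density nu pYX)
    (pY_density : is_density nu pY)
    (omega_ge1 : 1 <= omega)
    (bounding : bounding_condition pYX pY omega)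
    (X_law : has_law mu X pX)
    (U_law : forall i A, measurable A ->
       distribution P (U i) A = uniform_prob (@ltr01 R) A)
    (Y_law : forall i, has_law nu (Y i) pY).

Let F := sampler_sigma X (fun i => U i) (fun i => Y i).
Hypothesis indep : mutually_independent P F.

Local Notation block J := (g_sigma_algebraType (block_events F J)).

Let F_measurable i : F i `<=` measurable.
Proof.
by case: i => [[i|i]|] _ [B mB <-]; apply: measurableI => //; rewrite -[X in measurable X]setTI; exact: measurable_funP.
Qed.

Let F_setT i : F i setT.
Proof. by case: i => [[i|i]|]; exists setT; rewrite ?preimage_setT ?setTI. Qed.

Let F_setI i : setI_closed (F i).
Proof.
by case: i => [[i|i]|] _ _ [A mA <-] [B mB <-]; exists (A `&` B);
  rewrite ?preimage_setI ?setTI//; exact: measurableI.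
Qed.

Lemma measurable_source (J : pred (option (nat + nat))) : J None ->
  measurable_fun setT (X : block J -> TX).
Proof.
move=> JN; apply: block_measurable => A mA; exists None => //.
by exists A; rewrite ?setTI.
Qed.

Lemma measurable_threshold (J : pred (option (nat + nat))) i : J (Some (inl i)) ->
  measurable_fun setT (U i : block J -> R).
Proof.
move=> Ji; apply: block_measurable => A mA; exists (Some (inl i)) => //.
by exists A; rewrite ?setTI.
Qed.

Lemma measurable_proposal (J : pred (option (nat + nat))) i : J (Some (inr i)) ->
  measurable_fun setT (Y i : block J -> TY).
Proof.
move=> Ji; apply: block_measurable => A mA; exists (Some (inr i)) => //.
by exists A; rewrite ?setTI.
Qed.

(** * Integrating out a threshold or a proposal *)

(** With the block frozen, the independent uniform threshold is at most [b w] with probability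
    [b w]. The function [g] of the comparison treats acceptance and rejection together. *)
Lemma integral_threshold (J : pred (option (nat + nat))) (h : Omega -> \bar R)
    (b : Omega -> R) (g : bool -> R) i :
  ~~ J (Some (inl i)) ->
  measurable_fun setT (h : block J -> \bar R) -> (forall w, 0 <= h w)%E ->
  measurable_fun setT (b : block J -> R) -> (forall w, 0 <= b w <= 1) ->
  (forall c, 0 <= g c) ->
  (\int[P]_w (h w * (g (U i w <= b w)%R)%:E) =
   \int[P]_w (h w * (b w * g true + (1 - b w) * g false)%:E))%E.
Proof.
move=> Ji mh h0 mb b01 g0.
pose J2 : pred (option (nat + nat)) := pred1 (Some (inl i)).
pose f (z : block J * block J2) := (h z.1 * (g (U i z.2 <= b z.1)%R)%:E)%E.
have mg : measurable_fun setT g by [].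
have mU : measurable_fun setT (U i : block J2 -> R).
  by apply: measurable_threshold; rewrite /J2/=.
have mf : measurable_fun setT f.
  apply: emeasurable_funM; first exact: measurableT_comp.
  apply/measurable_EFinP; apply: (measurableT_comp mg).
  by apply: measurable_fun_ler; exact: measurableT_comp.
rewrite (decoupling F_measurable F_setT F_setI indep (J1 := J) (J2 := J2) (f := f)) //.
- apply: eq_integral => w _; rewrite /f/=.
  rewrite ge0_integralZl//; last first.
  + by move=> y _; rewrite lee_fin.
  + apply/measurable_EFinP; apply: (measurableT_comp mg).
    by apply: measurable_fun_ler.
  congr (_ * _)%E.
  set A : set Omega := U i @^-1` `]-oo, b w].
  have mA : measurable A by rewrite -[X in measurable X]setTI; exact: measurable_funP.
  have PA : P A = (b w)%:E by rewrite -(uniform_prob_le (b01 w)) -(U_law i).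
  rewrite (eq_integral (fun y => ((g true)%:E * (\1_A y)%:E + (g false)%:E * (\1_(~` A) y)%:E)%E)).
    rewrite ge0_integralD//=; first last.
    * apply/measurable_EFinP; apply: measurable_funM => //; exact: measurable_indic (measurableC mA).
    * by move=> y _; rewrite mule_ge0 ?lee_fin.
    * by apply/measurable_EFinP; apply: measurable_funM => //; exact: measurable_indic.
    * by move=> y _; rewrite mule_ge0 ?lee_fin.
    rewrite !ge0_integralZl ?lee_fin//.
    * rewrite !integral_indic//; last exact: measurableC.
      rewrite !setIT.
      have PAC : P (~` A) = (1 - b w)%:E by rewrite probability_setC// PA.
      transitivity ((g true)%:E * (b w)%:E + (g false)%:E * (1 - b w)%:E)%E.
        by congr (_ * _ + _ * _)%E.
      by rewrite -!EFinM -EFinD mulrC [_ * g false]mulrC.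
    * by apply/measurable_EFinP; exact: measurable_indic (measurableC mA).
    * by apply/measurable_EFinP; exact: measurable_indic.
  move=> y _; rewrite !indicE in_setC.
  have -> : (y \in A) = (U i y <= b w) by apply/idP/idP; rewrite inE /A /= in_itv.
  by case: (U i y <= b w); rewrite ?mule0 ?mule1 ?add0e ?adde0.
- by move=> j Jj; apply: contraNneq Ji => <-.
- by move=> z; rewrite /f mule_ge0 ?lee_fin.
Qed.

Lemma integral_proposal (J : pred (option (nat + nat)))
    (f : block J * TY -> \bar R) i :
  ~~ J (Some (inr i)) -> measurable_fun setT f -> (forall z, 0 <= f z)%E ->
  (\int[P]_w f (w, Y i w) = \int[P]_w \int[nu]_y (f (w, y) * (pY y)%:E))%E.
Proof.
move=> Ji mf f0.
pose J2 : pred (option (nat + nat)) := pred1 (Some (inr i)).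
pose f' (z : block J * block J2) := f (z.1, Y i z.2).
have mY : measurable_fun setT (Y i : block J2 -> TY).
  by apply: measurable_proposal; rewrite /J2/=.
have mf' : measurable_fun setT f'.
  by apply: measurableT_comp => //; apply/measurable_fun_pair => //; exact: measurableT_comp.
rewrite (decoupling F_measurable F_setT F_setI indep (J1 := J) (J2 := J2) (f := f')) //.
- apply: eq_integral => w _; rewrite /f'/=.
  apply: (integral_has_law (f := fun y => f (w, y)) pY_density (Y_law i)) => //.
  exact: (@measurable_fun_pair2 _ _ _ (block J) _ _ f w mf).
- by move=> j Jj; apply: contraNneq Ji => <-.
- by move=> z; exact: f0.
Qed.

(** * Acceptance and rejection of candidates *)

Definition acceptance (x : TX) (y : TY) : R := pYX x y / (omega * pY y).

Definition accepted (i : nat) (w : Omega) : bool :=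
  U i w <= acceptance (X w) (Y i w).

Let omega_gt0 : 0 < omega. Proof. exact: lt_le_trans omega_ge1. Qed.

Let pYX_ge0 x y : 0 <= pYX x y. Proof. by have [_ /(_ x)[_ + _]] := pYX_density; apply. Qed.

Let pY_ge0 y : 0 <= pY y. Proof. by have [_ + _] := pY_density; apply. Qed.

Let pX_ge0 x : 0 <= pX x. Proof. by have [_ + _] := pX_density; apply. Qed.

(** This makes the convention z / 0 = 0 harmless: [acceptance_pY] and [acceptance01] hold at every
    point, zeros of [pY] included. *)
Let pYX_eq0 x y : pY y = 0 -> pYX x y = 0.
Proof.
by move=> y0; apply/le_anti; rewrite pYX_ge0 andbT (le_trans (bounding x y))// y0 mulr0.
Qed.

Lemma acceptance_pY x y : acceptance x y * pY y = pYX x y / omega.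
Proof.
rewrite /acceptance; have [y0|y0] := eqVneq (pY y) 0.
  by rewrite pYX_eq0// !mul0r.
by rewrite invfM mulrA mulfVK.
Qed.

Lemma acceptance01 x y : 0 <= acceptance x y <= 1.
Proof.
rewrite /acceptance divr_ge0 ?mulr_ge0 ?(ltW omega_gt0)//=.
have [y0|y0] := eqVneq (pY y) 0; first by rewrite pYX_eq0// !mul0r.
by rewrite ler_pdivrMr ?mul1r// mulr_gt0// lt_neqAle eq_sym y0 pY_ge0.
Qed.

Let measurable_pYX : measurable_fun setT (fun z : TX * TY => pYX z.1 z.2).
Proof. by have [] := pYX_density. Qed.

Let measurable_pY : measurable_fun setT pY.
Proof. by have [] := pY_density. Qed.

Let measurable_pX : measurable_fun setT pX.
Proof. by have [] := pX_density. Qed.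

Lemma measurable_acceptance :
  measurable_fun setT (fun z : TX * TY => acceptance z.1 z.2).
Proof.
apply: measurable_funM => //; apply: (measurableT_comp (@measurable_invr R)).
by apply: measurable_funM => //; exact: measurableT_comp.
Qed.

Lemma measurable_accepted (J : pred (option (nat + nat))) i :
  J None -> J (Some (inl i)) -> J (Some (inr i)) ->
  measurable_fun setT (accepted i : block J -> bool).
Proof.
move=> JN Jl Jr; apply: measurable_fun_ler; first exact: measurable_threshold.
apply: (measurableT_comp measurable_acceptance (g := fun w : block J => (X w, Y i w))).
by apply/measurable_fun_pair; [exact: measurable_source|exact: measurable_proposal].
Qed.

(** Given the source x, a candidate is accepted with probability equal to the integral of pYX x y /
    omega, that is 1/omega for every x. So the factor is constant although [h] may depend on the
    source. *)
Lemma integral_accepted (J : pred (option (nat + nat))) (h : Omega -> \bar R)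
    (g : bool -> R) i :
  J None -> ~~ J (Some (inl i)) -> ~~ J (Some (inr i)) ->
  measurable_fun setT (h : block J -> \bar R) -> (forall w, 0 <= h w)%E ->
  (forall c, 0 <= g c) ->
  (\int[P]_w (h w * (g (accepted i w))%:E) =
   (omega^-1 * g true + (1 - omega^-1) * g false)%:E * \int[P]_w h w)%E.
Proof.
move=> JN Jl Jr mh h0 g0.
pose J1 : pred (option (nat + nat)) := predU (pred1 (Some (inr i))) J.
have J1N : J1 None by rewrite /J1/= JN.
have J1r : J1 (Some (inr i)) by rewrite /J1/= eqxx.
rewrite (integral_threshold (J := J1) (h := h)
  (b := fun w => acceptance (X w) (Y i w)) (g := g)) //; first last.
- by move=> w; exact: acceptance01.
- apply: (measurableT_comp measurable_acceptance (g := fun w : block J1 => (X w, Y i w))).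
  by apply/measurable_fun_pair; [exact: measurable_source|exact: measurable_proposal].
- by apply: block_measurableW mh => j Jj; rewrite /J1/= Jj orbT.
have mix_ge0 x y : 0 <= acceptance x y * g true + (1 - acceptance x y) * g false.
  have /andP[a0 a1] := acceptance01 x y.
  by rewrite addr_ge0// mulr_ge0// subr_ge0.
pose f (z : block J * TY) := (h z.1 * (acceptance (X z.1) z.2 * g true +
  (1 - acceptance (X z.1) z.2) * g false)%:E)%E.
have mf : measurable_fun setT f.
  apply: emeasurable_funM; first exact: measurableT_comp.
  have ma : measurable_fun setT (fun z : block J * TY => acceptance (X z.1) z.2).
    apply: (measurableT_comp measurable_acceptance (g := fun z : block J * TY => (X z.1, z.2))).
    apply/measurable_fun_pair => //.
    apply: (measurableT_comp (f := (X : block J -> TX))) => //.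
    exact: measurable_source.
  apply/measurable_EFinP; apply: measurable_funD; apply: measurable_funM => //.
  exact: measurable_funB.
rewrite (integral_proposal (J := J) (f := f))//; last first.
  by move=> z; rewrite /f mule_ge0// lee_fin.
rewrite -ge0_integralZl//; first last.
- rewrite lee_fin addr_ge0// mulr_ge0//.
    by rewrite invr_ge0 ltW.
  by rewrite subr_ge0 invf_le1.
- exact: block_measurable_fun mh.
apply: eq_integral => w _; rewrite /f/= muleC.
transitivity (h w * \int[nu]_y ((acceptance (X w) y * g true +
    (1 - acceptance (X w) y) * g false)%:E * (pY y)%:E))%E.
  rewrite -ge0_integralZl//.
  - by apply: eq_integral => y _; rewrite muleA.
  - apply: emeasurable_funM; last exact/measurable_EFinP.
    have ma : measurable_fun setT (acceptance (X w)).
      exact: (measurable_fun_pair2 (X w) measurable_acceptance).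
    apply/measurable_EFinP; apply: measurable_funD; apply: measurable_funM => //.
    exact: measurable_funB.
  - by move=> y _; rewrite mule_ge0 ?lee_fin.
congr (_ * _)%E.
have [_ /(_ (X w)) dYX] := pYX_density.
(* By [acceptance_pY] only the two densities remain, each of mass 1. The coefficient
   [g true - g false] may be negative, so linearity rests on integrability here. *)
transitivity (\int[nu]_y ((g false)%:E * (pY y)%:E +
    (omega^-1 * (g true - g false))%:E * (pYX (X w) y)%:E))%E.
  apply: eq_integral => y _; rewrite -!EFinM -EFinD; congr EFin.
  rewrite (_ : omega^-1 * _ * _ = pYX (X w) y / omega * (g true - g false)); last by ring.
  by rewrite -acceptance_pY; ring.
rewrite integralD//=; first last.
- by apply: integrableZl => //; exact: integrable_density.
- by apply: integrableZl => //; exact: integrable_density.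
rewrite !integralZl//; [|exact: integrable_density..].
have [_ _ ->] := dYX; have [_ _ ->] := pY_density.
rewrite !mule1 -EFinD; congr EFin; ring.
Qed.

(** The induction moves the indicator of one candidate into [h] and its two variables into [J]. An
    arbitrary list is allowed because [integral_rank_term] leaves out one candidate of an initial
    segment. *)
Lemma integral_all_rejected (s : seq nat) (J : pred (option (nat + nat)))
    (h : Omega -> \bar R) :
  uniq s -> J None ->
  (forall j, j \in s -> ~~ J (Some (inl j)) && ~~ J (Some (inr j))) ->
  measurable_fun setT (h : block J -> \bar R) -> (forall w, 0 <= h w)%E ->
  (\int[P]_w (h w * (all (fun j => ~~ accepted j w) s)%:R%:E) =
   ((1 - omega^-1) ^+ size s)%:E * \int[P]_w h w)%E.
Proof.
have q0 : 0 <= 1 - omega^-1 by rewrite subr_ge0 invf_le1.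
elim: s J h => [|l s IH] J h /=.
  by move=> *; rewrite expr0 mul1e; apply: eq_integral => w _; rewrite mule1.
move=> /andP[ls us] JN Js mh h0.
pose J1 : pred (option (nat + nat)) :=
  predU (pred2 (Some (inl l)) (Some (inr l))) J.
have /andP[Jl Jr] : ~~ J (Some (inl l)) && ~~ J (Some (inr l)).
  by apply: Js; rewrite inE eqxx.
transitivity (\int[P]_w ((h w * (~~ accepted l w)%:R%:E) *
    (all (fun j => ~~ accepted j w) s)%:R%:E))%E.
  by apply: eq_integral => w _; rewrite -muleA -EFinM -natrM mulnb.
rewrite (IH J1)//; first last.
- by move=> w; rewrite mule_ge0// lee_fin.
- apply: emeasurable_funM.
    by apply: block_measurableW mh => j Jj; rewrite /J1/= Jj orbT.
  apply/measurable_EFinP; apply: (measurableT_comp (f := fun b : bool => (~~ b)%:R : R)) => //.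
  by apply: measurable_accepted; rewrite /J1/= ?eqxx ?JN ?orbT.
- move=> j js; have /andP[Jjl Jjr] : ~~ J (Some (inl j)) && ~~ J (Some (inr j)).
    by apply: Js; rewrite inE js orbT.
  rewrite /J1/= !negb_or Jjl Jjr !andbT/=.
  by apply/andP; split; apply: contraNneq ls => -[<-].
rewrite (integral_accepted (J := J) (h := h) (g := fun b => (~~ b)%:R))//=.
by rewrite mulr0 add0r mulr1 muleA -EFinM exprSr.
Qed.

Lemma integral_joint i (f : TX * TY -> \bar R) :
  measurable_fun setT f -> (forall z, 0 <= f z)%E ->
  (\int[P]_w f (X w, Y i w) =
   \int[(mu \x nu)%E]_z (f z * (pX z.1 * pY z.2)%:E))%E.
Proof.
move=> mf f0.
pose J : pred (option (nat + nat)) := pred1 None.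
pose f' (z : block J * TY) := f (X z.1, z.2).
have mf' : measurable_fun setT f'.
  apply: (measurableT_comp mf); apply/measurable_fun_pair => //.
  by apply: (measurableT_comp (f := (X : block J -> TX))) => //; exact: measurable_source.
rewrite (integral_proposal (J := J) (f := f'))//; last by move=> z; exact: f0.
rewrite /f'/=.
pose f1 (z : TX * TY) := (f z * (pY z.2)%:E)%E.
have mf1 : measurable_fun setT f1.
  by apply: emeasurable_funM => //; apply/measurable_EFinP; exact: measurableT_comp.
have f10 z : (0 <= f1 z)%E by rewrite mule_ge0 ?lee_fin.
rewrite (integral_has_law (f := fun x => \int[nu]_y f1 (x, y))%E pX_density X_law); first last.
- by move=> x; apply: integral_ge0.
- exact: measurable_fun_fubini_tonelli_F.
rewrite fubini_tonelli1/=; first last.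
- by move=> z; rewrite mule_ge0 ?lee_fin ?mulr_ge0.
- apply: emeasurable_funM => //; apply/measurable_EFinP.
  by apply: measurable_funM; exact: measurableT_comp.
apply: eq_integral => x _; rewrite /fubini_F/= muleC -ge0_integralZl ?lee_fin//; last first.
  exact: (measurable_fun_pair2 x mf1).
by apply: eq_integral => y _; rewrite /f1/= EFinM [RHS]muleCA.
Qed.

(** Acceptance multiplies the product density pX pY by pYX / (omega pY), which leaves the joint
    density over omega. *)
Lemma integral_joint_accepted i (f : TX * TY -> \bar R) :
  measurable_fun setT f -> (forall z, 0 <= f z)%E ->
  (\int[P]_w (f (X w, Y i w) * (accepted i w)%:R%:E) = (omega^-1)%:E *
   \int[(mu \x nu)%E]_z (f z * (pX z.1 * pYX z.1 z.2)%:E))%E.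
Proof.
move=> mf f0.
pose J : pred (option (nat + nat)) := pred2 None (Some (inr i)).
have mXY : measurable_fun setT (fun w : block J => (X w, Y i w)).
  apply/measurable_fun_pair; first exact: measurable_source.
  by apply: measurable_proposal; rewrite /J/= eqxx.
rewrite (integral_threshold (J := J) (h := fun w => f (X w, Y i w))
  (b := fun w => acceptance (X w) (Y i w)) (g := fun b => b%:R))//; first last.
- by move=> w; exact: acceptance01.
- exact: (measurableT_comp measurable_acceptance mXY).
- exact: (measurableT_comp mf mXY).
have ma0 z : 0 <= acceptance z.1 z.2 by have /andP[] := acceptance01 z.1 z.2.
rewrite (integral_joint i (f := fun z => f z * (acceptance z.1 z.2 * true%:R +
   (1 - acceptance z.1 z.2) * false%:R)%:E)%E); first last.
- by move=> z; rewrite mulr1 mulr0 addr0 mule_ge0// lee_fin.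
- apply: emeasurable_funM => //; apply/measurable_EFinP.
  have := measurable_acceptance; apply: eq_measurable_fun => z _.
  by rewrite mulr1 mulr0 addr0.
rewrite -ge0_integralZl//.
- apply: eq_integral => z _; rewrite mulr1 mulr0 addr0 -muleA [RHS]muleCA; congr (_ * _)%E.
  rewrite -!EFinM; congr EFin.
  rewrite (_ : omega^-1 * _ = pX z.1 * (pYX z.1 z.2 / omega)); last by ring.
  by rewrite -acceptance_pY; ring.
- apply: emeasurable_funM => //; apply/measurable_EFinP.
  by apply: measurable_funM => //; exact: measurableT_comp.
- by move=> z _; rewrite mule_ge0 ?lee_fin ?mulr_ge0.
- by rewrite lee_fin invr_ge0 ltW.
Qed.

Lemma integral_joint_density :
  (\int[(mu \x nu)%E]_z (pX z.1 * pYX z.1 z.2)%:E = 1)%E.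
Proof.
rewrite fubini_tonelli1/=; first last.
- by move=> z; rewrite lee_fin mulr_ge0.
- apply/measurable_EFinP; apply: measurable_funM => //; exact: measurableT_comp.
have [_ _ <-] := pX_density; apply: eq_integral => x _; rewrite /fubini_F/=.
have [_ /(_ x)[mpx px0 px1]] := pYX_density.
under eq_integral do rewrite EFinM.
rewrite ge0_integralZl ?lee_fin//.
- by rewrite px1 mule1.
- exact/measurable_EFinP.
- by move=> y _; rewrite lee_fin.
Qed.

Lemma integral_product_density :
  (\int[(mu \x nu)%E]_z (pX z.1 * pY z.2)%:E = 1)%E.
Proof.
have := integral_joint 0 (f := fun=> 1%E).
rewrite integral_cst//= mul1e probability_setT => -> //.
by apply: eq_integral => z _; rewrite mul1e.
Qed.

(** Stopping at [k] as a conjunction over single candidates, the form in which independence applies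
    and no default value intervenes. *)
Definition first_accepted (k : nat) (w : Omega) : bool :=
  accepted k w && all (fun j => ~~ accepted j w) (iota 0 k).

Lemma integral_first_accepted k (f : TX * TY -> \bar R) :
  measurable_fun setT f -> (forall z, 0 <= f z)%E ->
  (\int[P]_w (f (X w, Y k w) * (first_accepted k w)%:R%:E) =
   ((1 - omega^-1) ^+ k / omega)%:E *
   \int[(mu \x nu)%E]_z (f z * (pX z.1 * pYX z.1 z.2)%:E))%E.
Proof.
move=> mf f0.
pose J : pred (option (nat + nat)) :=
  [pred j | [|| j == None, j == Some (inl k) | j == Some (inr k)]].
rewrite EFinM -muleA -(integral_joint_accepted k)//.
have := integral_all_rejected (s := iota 0 k) (J := J)
  (h := fun w => (f (X w, Y k w) * (accepted k w)%:R%:E)%E).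
rewrite size_iota => <-.
- by apply: eq_integral => w _; rewrite -muleA -EFinM -natrM mulnb.
- exact: iota_uniq.
- by [].
- move=> j; rewrite mem_iota add0n leq0n/= => jk.
  have {}jk : j != k by rewrite neq_ltn jk.
  by rewrite /J/= !negb_or/= !andbT; apply/andP; split; apply: contraNneq jk => -[->].
- apply: emeasurable_funM.
    apply: (measurableT_comp mf (g := fun w : block J => (X w, Y k w))).
    apply/measurable_fun_pair; first exact: measurable_source.
    by apply: measurable_proposal; rewrite /J/= ?eqxx ?orbT.
  apply/measurable_EFinP; apply: (measurableT_comp (f := fun b : bool => b%:R : R)) => //.
  by apply: measurable_accepted; rewrite /J/= ?eqxx ?orbT.
- by move=> w; rewrite mule_ge0 ?lee_fin.
Qed.

Lemma measurable_accepted_sample i : measurable_fun setT (accepted i).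
Proof. by apply: (block_measurable_fun F_measurable (J := predT)); exact: measurable_accepted. Qed.

Lemma measurable_all_rejected s :
  measurable_fun setT (fun w => all (fun j => ~~ accepted j w) s).
Proof.
elim: s => [|j s IH] /=; first exact: measurable_cst.
by apply: measurable_and => //; apply: measurable_neg; exact: measurable_accepted_sample.
Qed.

Lemma measurable_first_accepted k : measurable_fun setT (first_accepted k).
Proof.
apply: measurable_and; first exact: measurable_accepted_sample.
exact: measurable_all_rejected.
Qed.

(** * Contribution of a single competitor to the weighted rank *)

Section rank_weight.
(** [phi] stands for 1 / rho. Only phi pYX <= pY is imposed, which leaves its value free where [pYX]
    vanishes. *)
Variable phi : TX * TY -> R.
Hypotheses (mphi : measurable_fun setT phi) (phi_ge0 : forall z, 0 <= phi z)
  (phi_pYX : forall z, phi z * pYX z.1 z.2 <= pY z.2).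

Lemma weight_acceptance_le z : phi z * acceptance z.1 z.2 <= omega^-1.
Proof.
rewrite /acceptance; have [y0|y0] := eqVneq (pY z.2) 0.
  by rewrite y0 mulr0 invr0 !mulr0 invr_ge0 ltW.
have y1 : 0 < pY z.2 by rewrite lt_neqAle eq_sym y0 pY_ge0.
by rewrite mulrA ler_pdivrMr ?mulr_gt0// mulrA mulVf ?mul1r// gt_eqF.
Qed.

(** Given the source and proposal [k], threshold [i] is at most the acceptance probability a with
    probability a, and phi a <= 1/omega. Acceptance of [k] supplies the second 1/omega, the
    remaining rejections the power. *)
Lemma integral_rank_term i k : i != k ->
  (\int[P]_w ((phi (X w, Y k w))%:E *
     (first_accepted k w && (U i w < U k w)%R)%:R%:E) <=
   ((1 - omega^-1) ^+ k.-1 / omega ^+ 2)%:E)%E.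
Proof.
move=> ik.
pose J : pred (option (nat + nat)) :=
  [pred j | [|| j == None, j == Some (inl k) | j == Some (inr k)]].
pose J1 : pred (option (nat + nat)) := predU (pred1 (Some (inl i))) J.
have J1J j : J j -> J1 j by move=> Jj; rewrite /J1/= Jj orbT.
have q01 : 0 <= 1 - omega^-1 <= 1.
  by rewrite subr_ge0 invf_le1// omega_ge1 lerBlDr lerDl invr_ge0 ltW.
have mXY : measurable_fun setT (fun w : block J => (X w, Y k w)).
  apply/measurable_fun_pair; first exact: measurable_source.
  by apply: measurable_proposal; rewrite /J/= ?eqxx ?orbT.
pose a w := acceptance (X w) (Y k w).
pose h w : \bar R := ((phi (X w, Y k w))%:E * (accepted k w)%:R%:E)%E.
have mh : measurable_fun setT (h : block J -> \bar R).
  apply: emeasurable_funM; first by apply/measurable_EFinP; exact: (measurableT_comp mphi mXY).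
  apply/measurable_EFinP; apply: (measurableT_comp (f := fun b : bool => b%:R : R)) => //.
  by apply: measurable_accepted; rewrite /J/= ?eqxx ?orbT.
have h0 w : (0 <= h w)%E by rewrite mule_ge0 ?lee_fin.
have ma : measurable_fun setT (a : block J -> R).
  exact: (measurableT_comp measurable_acceptance mXY).
pose h1 w : \bar R := (h w * (U i w <= a w)%R%:R%:E)%E.
have mU : measurable_fun setT (fun w : block J1 => (U i w <= a w)%R).
  apply: measurable_fun_ler; last exact: block_measurableW ma.
  by apply: measurable_threshold; rewrite /J1/= eqxx.
have mh1 : measurable_fun setT (h1 : block J1 -> \bar R).
  apply: emeasurable_funM; first exact: block_measurableW mh.
  apply/measurable_EFinP.
  exact: (measurableT_comp (f := fun b : bool => b%:R : R)).
have h10 w : (0 <= h1 w)%E by rewrite /h1 mule_ge0// lee_fin.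
(* Whether [i] lies before or after [k], at least k - 1 of the rejections survive its removal. *)
pose s := [seq j <- iota 0 k | j != i].
have size_s : (k.-1 <= size s)%N.
  rewrite size_filter -(leq_add2r (count (pred1 i) (iota 0 k))).
  rewrite (_ : count (fun j => j != i) _ = count (predC (pred1 i)) (iota 0 k))//.
  rewrite addnC [leqRHS]addnC count_predC size_iota.
  rewrite count_uniq_mem ?iota_uniq// mem_iota add0n leq0n/=.
  have aux (m : nat) : ((i < m) + m.-1 <= m)%N.
    by case: m => // m; rewrite /= -[leqRHS]add1n leq_add2r leq_b1.
  exact: aux.
(* Acceptance of [k] means U_k <= a, so U_i < U_k implies U_i <= a, a condition free of U_k. *)
apply: (@le_trans _ _ (\int[P]_w (h1 w * (all (fun j => ~~ accepted j w) s)%:R%:E))%E).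
  apply: ge0_le_integral => //.
  - by move=> w _; rewrite mule_ge0 ?lee_fin.
  - apply: emeasurable_funM.
      apply/measurable_EFinP; apply: (measurableT_comp mphi (g := fun w => (X w, Y k w))).
      exact/measurable_fun_pair.
    apply: measurable_natr_bool; apply: measurable_and; first exact: measurable_first_accepted.
    exact: measurable_fun_ltr.
  - apply: emeasurable_funM; first exact: block_measurable_fun mh1.
    exact/measurable_natr_bool/measurable_all_rejected.
  - move=> w _; rewrite /h1 /h /first_accepted -!muleA -!EFinM -!natrM !mulnb.
    rewrite lee_fin ler_wpM2l// ler_nat.
    case: (boolP (accepted k w)) => //= acc.
    case: allP => //= rej; case: (boolP (U i w < U k w)%R) => //= Uik.
    rewrite (ltW (lt_le_trans Uik acc)) andTb.
    rewrite (_ : all _ s = true)//; apply/allP => j; rewrite mem_filter => /andP[_].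
    exact: rej.
rewrite (integral_all_rejected (J := J1))//; first last.
- move=> j; rewrite mem_filter mem_iota add0n leq0n/= => /andP[ji jk].
  have {}jk : j != k by rewrite neq_ltn jk.
  have E1 m : (Some (inl j) == Some (inl m) :> option (nat + nat)) = (j == m) by [].
  have E2 m : (Some (inr j) == Some (inr m) :> option (nat + nat)) = (j == m) by [].
  by rewrite /J1 /J/= !E1 !E2 (negbTE ji) (negbTE jk).
- exact/filter_uniq/iota_uniq.
rewrite /h1 (integral_threshold (J := J) (h := h) (b := a) (g := fun b => b%:R))//; first last.
- by move=> w; exact: acceptance01.
- have E1 : (Some (inl i) == Some (inl k) :> option (nat + nat)) = (i == k) by [].
  by rewrite /J/= E1 (negbTE ik).
pose f z := (phi z * acceptance z.1 z.2)%:E.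
have f0 z : (0 <= f z)%E.
  by rewrite lee_fin mulr_ge0//; have /andP[] := acceptance01 z.1 z.2.
have mf : measurable_fun setT f.
  by apply/measurable_EFinP; apply: measurable_funM => //; exact: measurable_acceptance.
rewrite (eq_integral (fun w => f (X w, Y k w) * (accepted k w)%:R%:E)%E); last first.
  move=> w _; rewrite /h /f mulr1 mulr0 addr0 -!EFinM; congr EFin.
  by rewrite mulrAC.
rewrite integral_joint_accepted//.
have f_le z : (f z <= (omega^-1)%:E)%E.
  by rewrite lee_fin; exact: weight_acceptance_le.
have I1 : (\int[(mu \x nu)%E]_z (f z * (pX z.1 * pYX z.1 z.2)%:E) <= (omega^-1)%:E)%E.
  rewrite -[leRHS]mule1 -integral_joint_density -ge0_integralZl//.
  - apply: ge0_le_integral => //.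
    + by move=> z _; rewrite mule_ge0// lee_fin mulr_ge0.
    + apply: emeasurable_funM => //; apply/measurable_EFinP.
      by apply: measurable_funM => //; exact: measurableT_comp.
    + apply: emeasurable_funM => //; apply/measurable_EFinP.
      by apply: measurable_funM => //; exact: measurableT_comp.
    + by move=> z _; rewrite lee_wpmul2r// lee_fin mulr_ge0.
  - by apply/measurable_EFinP; apply: measurable_funM => //; exact: measurableT_comp.
  - by move=> z _; rewrite lee_fin mulr_ge0.
  - by rewrite lee_fin invr_ge0 ltW.
apply: (@le_trans _ _ (((1 - omega^-1) ^+ size s)%:E * ((omega^-1)%:E * (omega^-1)%:E))%E).
  rewrite lee_wpmul2l ?lee_fin ?exprn_ge0//; first by case/andP: q01.
  by rewrite lee_wpmul2l// lee_fin invr_ge0 ltW.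
rewrite -!EFinM lee_fin -invfM -expr2 ler_wpM2r ?invr_ge0 ?exprn_ge0 ?(ltW omega_gt0)//.
by case/andP: q01 => q0 q1; rewrite ler_wiXn2l.
Qed.

(** The weight turns the joint density into at most the product density, whose mass is 1. *)
Lemma integral_weight k :
  (\int[P]_w ((phi (X w, Y k w))%:E * (first_accepted k w)%:R%:E) <=
   ((1 - omega^-1) ^+ k / omega)%:E)%E.
Proof.
have mf : measurable_fun setT (EFin \o phi) by exact/measurable_EFinP.
rewrite (integral_first_accepted k (f := EFin \o phi))//.
rewrite -[leRHS]mule1 lee_wpmul2l//.
  by rewrite lee_fin divr_ge0 ?exprn_ge0 ?(ltW omega_gt0)// subr_ge0 invf_le1.
rewrite -integral_product_density; apply: ge0_le_integral => //.
- by move=> z _; rewrite /= -EFinM lee_fin !mulr_ge0.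
- apply: emeasurable_funM => //; apply/measurable_EFinP.
  by apply: measurable_funM => //; exact: measurableT_comp.
- by apply/measurable_EFinP; apply: measurable_funM; exact: measurableT_comp.
- by move=> z _; rewrite /= -EFinM lee_fin mulrCA ler_wpM2l.
Qed.

End rank_weight.

(** * The selected index *)

(** Zero-based: [rejection_index] is its successor. The value 0 also stands for the rejection of
    every candidate, so only a positive value certifies acceptance. *)
Definition selected (w : Omega) : nat := first_index (accepted ^~ w).

Lemma selectedE k w : first_accepted k w -> selected w = k.
Proof.
rewrite /selected /first_index => /andP[acc /allP rej].
case: pselect => [ex|nex] /=; last by exfalso; apply: nex; exists k.
case: ex_minnP => m accm min_m; apply/eqP; rewrite eqn_leq min_m//= leqNgt.
by apply/negP => mk; have := rej m; rewrite mem_iota mk accm => /(_ isT).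
Qed.

Lemma selected_rejected k w : (k < selected w)%N -> ~~ accepted k w.
Proof.
rewrite /selected /first_index; case: pselect => [ex|nex] //=.
by case: ex_minnP => m accm min_m km; apply: contraL km => /min_m; rewrite leqNgt.
Qed.

Lemma selected_gt0 w : (0 < selected w)%N -> first_accepted (selected w) w.
Proof.
move=> s0; apply/andP; split; last first.
  by apply/allP => j; rewrite mem_iota => /= /selected_rejected.
by move: s0; rewrite /selected /first_index; case: pselect => [ex|nex] //=; case: ex_minnP.
Qed.

Lemma measurable_selected : measurable_fun setT selected.
Proof.
have mD k : measurable [set w | first_accepted k w].
  rewrite -[X in measurable X]setTI.
  exact: (measurable_first_accepted k measurableT (Y := [set true])).
have ms k : measurable [set w | selected w = k].
  case: k => [|k]; last first.
    rewrite (_ : mkset _ = [set w | first_accepted k.+1 w])//.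
    rewrite predeqE => w /=; split => [sk|/selectedE//].
    by rewrite -sk selected_gt0// sk.
  (* The fibre over 0 mixes selection of candidate 0 with the default value, hence the
     complement. *)
  rewrite (_ : mkset _ = ~` \bigcup_k [set w | first_accepted k.+1 w]).
    by apply: measurableC; exact: bigcup_measurable.
  rewrite predeqE => w /=; split => [s0 [k _ /= /selectedE]|nex]; first by rewrite s0.
  case: (posnP (selected w)) => // s0; exfalso; apply: nex.
  by exists (selected w).-1 => //=; rewrite prednK// selected_gt0.
move=> _ B _; rewrite setTI (_ : _ @^-1` _ = \bigcup_(k in B) [set w | selected w = k]).
  by apply: bigcup_measurable => k _; exact: ms.
by rewrite predeqE => w; split => [Bw|[k Bk /= ->]//]; exists (selected w).
Qed.

Lemma prob_all_rejected m :
  P [set w | all (fun j => ~~ accepted j w) (iota 0 m)] = ((1 - omega^-1) ^+ m)%:E.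
Proof.
pose J : pred (option (nat + nat)) := pred1 None.
have := integral_all_rejected (s := iota 0 m) (J := J) (h := fun=> 1%E).
rewrite size_iota integral_cst//= mul1e probability_setT mule1 => <-//; last exact: iota_uniq.
rewrite -integral_natr_bool; last exact: measurable_all_rejected.
by apply: eq_integral => w _; rewrite mul1e.
Qed.

Let q : R := 1 - omega^-1.

Let q_itv : 0 <= q < 1.
Proof. by rewrite subr_ge0 invf_le1// omega_ge1 ltrBlDr ltrDl invr_gt0. Qed.

Let one_minus_q : 1 - q = omega^-1.
Proof. by rewrite /q opprB addrCA subrr addr0. Qed.

(** The exceptional event lies, for every m, in the rejection of the first m candidates, of
    probability q^m. *)
Lemma ae_first_accepted : {ae P, forall w, exists k, first_accepted k w}.
Proof.
have mR m : measurable [set w | all (fun j => ~~ accepted j w) (iota 0 m)].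
  rewrite -[X in measurable X]setTI.
  exact: (measurable_all_rejected (iota 0 m) measurableT (Y := [set true])).
exists (\bigcap_m [set w | all (fun j => ~~ accepted j w) (iota 0 m)]); split.
- exact: bigcapT_measurable.
- apply/eqP; rewrite eq_le measure_ge0 andbT; apply/lee_addgt0Pr => e e0; rewrite add0e.
  have /andP[q0 q1] := q_itv.
  have [m qm] : exists m, q ^+ m < e.
    have qn : `|q| < 1 by rewrite ger0_norm.
    have := cvg_geometric 1 qn => /cvgrPdist_lt/(_ e e0)[m _ /(_ m (leqnn m))] /=.
    rewrite sub0r normrN mul1r ger0_norm ?exprn_ge0// => qme.
    by exists m.
  apply: (@le_trans _ _ (q ^+ m)%:E); last by rewrite lee_fin ltW.
  rewrite -prob_all_rejected; apply: le_measure; rewrite ?inE//.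
  + exact: bigcapT_measurable.
  + by move=> w; exact.
- move=> w /= nex m _ /=; apply/negPn/negP => /allPn[j _ /negPn accj].
  apply: nex; have ex : exists j, accepted j w by exists j.
  exists (selected w); rewrite /selected /first_index; case: pselect => //= ex'.
  case: ex_minnP => k acck min_k; rewrite /first_accepted acck/=.
  by apply/allP => i; rewrite mem_iota => /= ik; apply: contraL ik => /min_k; rewrite leqNgt.
Qed.

(** The events [selected w = k] and [first_accepted k w] agree outside the null set where everything
    is rejected. *)
Lemma integral_selected (f : nat -> Omega -> \bar R) :
  (forall k w, 0 <= f k w)%E -> (forall k, measurable_fun setT (f k)) ->
  (\int[P]_w f (selected w) w =
   \sum_(0 <= k <oo) \int[P]_w (f k w * (first_accepted k w)%:R%:E))%E.
Proof.
move=> f0 mf; rewrite (integral_random_index P measurable_selected f0 mf).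
apply: eq_eseriesr => k _; apply: ge0_ae_eq_integral => //.
- apply: emeasurable_funM => //; apply: measurable_natr_bool.
  exact: measurable_nat_eq measurable_selected.
- apply: emeasurable_funM => //; apply: measurable_natr_bool.
  exact: measurable_first_accepted.
- by move=> w _; rewrite mule_ge0 ?lee_fin.
- by move=> w _; rewrite mule_ge0 ?lee_fin.
apply: filterS ae_first_accepted => w [j accj] _; congr (_ * (nat_of_bool _)%:R%:E)%E.
rewrite (selectedE accj); apply/eqP/idP => [<-//|/selectedE <-].
by rewrite (selectedE accj).
Qed.

(** Correctness of rejection sampling: the pair has the joint density whatever the stopping index,
    and the weights q^k / omega sum to 1. *)
Lemma integral_selected_pair (f : TX * TY -> \bar R) :
  measurable_fun setT f -> (forall z, 0 <= f z)%E ->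
  (\int[(mu \x nu)%E]_z (f z * (pX z.1 * pYX z.1 z.2)%:E) < +oo)%E ->
  (\int[P]_w f (X w, Y (selected w) w) =
   \int[(mu \x nu)%E]_z (f z * (pX z.1 * pYX z.1 z.2)%:E))%E.
Proof.
move=> mf f0; set G := (\int[_]_z _)%E => Goo.
rewrite (integral_selected (f := fun k w => f (X w, Y k w)))//; last first.
  by move=> k; apply: (measurableT_comp mf); exact/measurable_fun_pair.
have G0 : (0 <= G)%E by apply: integral_ge0 => z _; rewrite mule_ge0 ?lee_fin ?mulr_ge0.
have Gfin : G \is a fin_num by rewrite ge0_fin_numE.
transitivity (\sum_(0 <= k <oo) (fine G / omega * q ^+ k)%:E)%E.
  apply: eq_eseriesr => k _; rewrite integral_first_accepted// -/G -{1}(fineK Gfin) -EFinM.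
  by congr EFin; rewrite /q; ring.
by rewrite nneseries_geometric// one_minus_q invrK divfK ?gt_eqF// fineK.
Qed.

(** The quotient is the sum over l of the indicators of (l + 1) n <= [selected]. Such an event needs
    (l + 1) n rejections, so its probability is at most 2^-(l+1) by [rejection_pow_le_half]. *)
Lemma integral_selected_div_le :
  (\int[P]_w ((selected w %/ Num.truncn omega)%:R%:E) <= 1)%E.
Proof.
set n := Num.truncn omega.
have n0 : (0 < n)%N by rewrite truncn_gt0.
have /andP[q0 q1] := q_itv.
have mb l : measurable_fun setT (fun w => l.+1 * n <= selected w)%N.
  exact: (measurableT_comp (f := fun k => (l.+1 * n <= k)%N) _ measurable_selected).
apply: (@le_trans _ _ (\int[P]_w \sum_(0 <= l <oo) ((l.+1 * n <= selected w)%N%:R : R)%:E)%E).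
  apply: ge0_le_integral => //.
  - apply/measurable_EFinP.
    exact: (measurableT_comp (f := fun k => (k %/ n)%:R : R) _ measurable_selected).
  - by apply: ge0_emeasurable_sum => // l _; exact: measurable_natr_bool.
  - move=> w _; apply: le_trans (nneseries_lim_ge (selected w %/ n) _); last first.
      by move=> l _ _; rewrite lee_fin.
    rewrite sumEFin lee_fin (eq_big_nat _ _ (F2 := fun=> 1)).
      by rewrite sumr_const_nat subn0.
    by move=> l /=; rewrite -leq_divRL// => ->.
rewrite integral_nneseries//; last by move=> l; exact: measurable_natr_bool.
have -> : (1 = \sum_(0 <= l <oo) (2^-1 * 2^-1 ^+ l)%:E :> \bar R)%E.
  rewrite nneseries_geometric.
    by congr EFin; field.
  by apply/andP; split; lra.
apply: lee_nneseries => [l _ _|l _]; first by apply: integral_ge0 => w _; rewrite lee_fin.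
rewrite integral_natr_bool// -exprS.
apply: (@le_trans _ _ (q ^+ (l.+1 * n))%:E).
  rewrite -prob_all_rejected; apply: le_measure; rewrite ?inE.
  - by rewrite -[X in measurable X]setTI; exact: (mb l measurableT [set true]).
  - rewrite -[X in measurable X]setTI.
    exact: (measurable_all_rejected (iota 0 (l.+1 * n)) measurableT (Y := [set true])).
  - move=> w /= lw; apply/allP => j; rewrite mem_iota => /= jl.
    by apply: selected_rejected; exact: leq_trans jl _.
by rewrite lee_fin mulnC exprM lerXn2r ?nnegrE ?exprn_ge0 ?rejection_pow_le_half.
Qed.

(** * Weighted rank of the selected candidate *)

Let n := Num.truncn omega.

Let n_gt0 : (0 < n)%N. Proof. by rewrite truncn_gt0. Qed.

Let others k := [seq i <- iota (k %/ n * n) n | i != k].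

Lemma size_others k : size (others k) = n.-1.
Proof.
have := count_predC (pred1 k) (iota (k %/ n * n) n).
rewrite count_uniq_mem ?iota_uniq// mem_iota leq_divM {1}(divn_eq k n) ltn_add2l ltn_mod n_gt0/=.
by rewrite /others size_filter size_iota add1n => /(congr1 predn).
Qed.

Lemma integral_rank_weight (phi : TX * TY -> R) : measurable_fun setT phi ->
  (forall z, 0 <= phi z) -> (forall z, phi z * pYX z.1 z.2 <= pY z.2) ->
  (\int[P]_w ((group_rank n (selected w).+1 (U ^~ w))%:R *
     phi (X w, Y (selected w) w))%:E <= 2%:E)%E.
Proof.
move=> mphi phi_ge0 phi_pYX.
have /andP[q0 q1] := q_itv.
have mphiE k : measurable_fun setT (fun w => (phi (X w, Y k w))%:E).
  apply/measurable_EFinP; apply: (measurableT_comp mphi).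
  exact/measurable_fun_pair.
have mlt i k : measurable_fun setT (fun w => (U i w < U k w)%R) by exact: measurable_fun_ltr.
pose f k w : \bar R := ((phi (X w, Y k w))%:E +
  \sum_(i <- others k) ((phi (X w, Y k w))%:E * (U i w < U k w)%R%:R%:E))%E.
have sum_ge0 k w : (0 <= \sum_(i <- others k) ((phi (X w, Y k w))%:E * ((U i w < U k w)%R%:R)%:E))%E.
  by apply: sume_ge0 => i _; rewrite mule_ge0 ?lee_fin.
have f0 k w : (0 <= f k w)%E by rewrite adde_ge0 ?lee_fin.
have mf k : measurable_fun setT (f k).
  apply: emeasurable_funD => //; apply: emeasurable_sum => i _.
  by apply: emeasurable_funM => //; exact: measurable_natr_bool.
rewrite (eq_integral (fun w => f (selected w) w)); last first.
  move=> w _; rewrite /f; set k := selected w.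
  under eq_bigr do rewrite -EFinM.
  rewrite sumEFin -EFinD -mulr_sumr -[X in (X + _)%:E]mulr1 -mulrDr mulrC group_rankE//.
  by rewrite big_filter.
rewrite integral_selected//.
apply: (@le_trans _ _ (\sum_(0 <= k <oo) ((omega^-1 * q ^+ k)%:E +
    ((n.-1)%:R / omega ^+ 2 * q ^+ k.-1)%:E))%E).
  apply: lee_nneseries => [k _ _|k _].
    by apply: integral_ge0 => w _; rewrite mule_ge0 ?lee_fin.
  rewrite (eq_integral (fun w => (phi (X w, Y k w))%:E * (first_accepted k w)%:R%:E +
      \sum_(i <- others k) ((phi (X w, Y k w))%:E *
        (first_accepted k w && (U i w < U k w)%R)%:R%:E))%E); last first.
    move=> w _; rewrite /f muleDl//.
    congr (_ + _)%E; rewrite ge0_sume_distrl.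
      by apply: eq_bigr => i _; rewrite -muleA -EFinM -natrM mulnb andbC.
    by move=> i _; rewrite mule_ge0 ?lee_fin.
  have mterm i : measurable_fun setT (fun w => (phi (X w, Y k w))%:E *
        (first_accepted k w && (U i w < U k w)%R)%:R%:E)%E.
    apply: emeasurable_funM => //; apply: measurable_natr_bool.
    by apply: measurable_and => //; exact: measurable_first_accepted.
  rewrite ge0_integralD//=; first last.
  - by apply: emeasurable_sum => i _; exact: mterm.
  - by move=> w _; apply: sume_ge0 => i _; rewrite mule_ge0 ?lee_fin.
  - by apply: emeasurable_funM => //; apply: measurable_natr_bool; exact: measurable_first_accepted.
  - by move=> w _; rewrite mule_ge0 ?lee_fin.
  apply: leeD; first by rewrite mulrC; exact: integral_weight.
  rewrite ge0_integral_sum//; last by move=> i w _; rewrite mule_ge0 ?lee_fin.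
  rewrite -(size_others k) big_seq_cond.
  apply: (@le_trans _ _ (\sum_(i <- others k) (q ^+ k.-1 / omega ^+ 2)%:E)%E).
    rewrite [leRHS]big_seq_cond; apply: lee_sum => i; rewrite andbT mem_filter => /andP[ik _].
    exact: integral_rank_term.
  rewrite sumEFin lee_fin big_const_seq count_predT iter_addr_0.
  by rewrite -[leLHS]mulr_natl -[leRHS]mulrA [X in _ <= _ * X]mulrC.
rewrite nneseriesD; first last.
- by move=> k _ _; rewrite lee_fin mulr_ge0 ?exprn_ge0// divr_ge0 ?exprn_ge0// ltW.
- by move=> k _ _; rewrite lee_fin mulr_ge0 ?exprn_ge0// invr_ge0 ltW.
rewrite nneseries_geometric// nneseries_geometric_pred//; last first.
  by rewrite divr_ge0 ?exprn_ge0// ltW.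
(* The series have become 1 and (n - 1) (1 + omega) / omega^2; as n <= omega, the numerator of the
   latter is at most omega^2 - 1. *)
rewrite one_minus_q !invrK mulVf ?gt_eqF// -EFinD lee_fin.
have c_le : (n.-1)%:R + 1 <= omega by rewrite natr1 prednK// truncn_le ltW.
have : (n.-1)%:R * (1 + omega) / omega ^+ 2 <= 1.
  rewrite ler_pdivrMr ?exprn_gt0// mul1r.
  have := ler_wpM2r (ltW (addr_gt0 ltr01 omega_gt0)) (_ : (n.-1)%:R <= omega - 1).
  rewrite lerBrDr => /(_ c_le) h; rewrite (le_trans h)//.
  rewrite expr2; nra.
rewrite (_ : _ * (1 + omega) / _ = (n.-1)%:R / omega ^+ 2 + (n.-1)%:R / omega ^+ 2 * omega).
  by move=> h; lra.
by ring.
Qed.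

(** * Density ratio and mutual information *)

Definition log_deficit (z : TX * TY) : R := ln omega - ln (pYX z.1 z.2 / pY z.2).

(** This is 1 / rho, except that it is 2 where rho = 0. There the inverse is 0 by convention and
    [ln_rank_le] would fail, whereas m * 2 / 2 = m dominates ln m + 1. *)
Definition rank_weight (z : TX * TY) : R :=
  (pYX z.1 z.2 / pY z.2)^-1 + 2 * (pYX z.1 z.2 / pY z.2 == 0)%:R.

Let ratio_ge0 z : 0 <= pYX z.1 z.2 / pY z.2. Proof. by rewrite divr_ge0. Qed.

Let measurable_ratio : measurable_fun setT (fun z : TX * TY => pYX z.1 z.2 / pY z.2).
Proof.
apply: measurable_funM => //; apply: (measurableT_comp (@measurable_invr R)).
exact: measurableT_comp.
Qed.

Lemma measurable_log_deficit : measurable_fun setT log_deficit.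
Proof.
apply: measurable_funB => //.
exact: (measurableT_comp (@measurable_ln R) measurable_ratio).
Qed.

Lemma log_deficit_ge0 z : 0 <= log_deficit z.
Proof.
have lomega : 0 <= ln omega by exact: ln_ge0.
rewrite subr_ge0; have := ratio_ge0 z; rewrite le_eqVlt => /orP[/eqP<-|r0].
  by rewrite ln0.
rewrite ler_ln ?posrE//.
have [y0|y0] := eqVneq (pY z.2) 0; first by move: r0; rewrite y0 invr0 mulr0 ltxx.
by rewrite ler_pdivrMr// lt_neqAle eq_sym y0 pY_ge0.
Qed.

Lemma measurable_rank_weight : measurable_fun setT rank_weight.
Proof.
apply: measurable_funD; first exact: (measurableT_comp (@measurable_invr R) measurable_ratio).
apply: measurable_funM => //.
apply: (measurableT_comp (f := fun b : bool => b%:R : R)) => //.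
exact: measurable_fun_eqr.
Qed.

Lemma rank_weight_ge0 z : 0 <= rank_weight z.
Proof. by rewrite addr_ge0 ?invr_ge0// mulr_ge0. Qed.

Lemma rank_weight_pYX z : rank_weight z * pYX z.1 z.2 <= pY z.2.
Proof.
rewrite /rank_weight; have [y0|y0] := eqVneq (pY z.2) 0.
  by rewrite pYX_eq0// mulr0 y0.
have [yx0|yx0] := eqVneq (pYX z.1 z.2) 0; first by rewrite yx0 mulr0.
rewrite mulf_eq0 invr_eq0 (negbTE y0) (negbTE yx0)/= mulr0 addr0 invf_div.
by rewrite divfK.
Qed.

(* Tangent line bound for [ln] at [2], applied to the rank times the inverse ratio. *)
Lemma ln_rank_le (m : nat) z : (0 < m)%N ->
  ln m%:R + log_deficit z + 1 <= ln omega + ln 2 + 2^-1 * (m%:R * rank_weight z).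
Proof.
move=> m0; have m1 : 0 < m%:R :> R by rewrite ltr0n.
rewrite /log_deficit /rank_weight; have := ratio_ge0 z.
move: (pYX z.1 z.2 / pY z.2) => rho; rewrite le_eqVlt => /orP[/eqP<-|r0].
  rewrite eqxx invr0 (ln0 (lexx 0)) subr0 add0r mulr1.
  have := ln_le_subr1 m1; have : 0 <= ln 2 :> R by rewrite ln_ge0// ler1n.
  lra.
rewrite (gt_eqF r0) mulr0 addr0.
have := ln_le_subr1 (divr_gt0 m1 (mulr_gt0 (ltr0n R 2) r0)).
have -> : ln (m%:R / (2 * rho)) = ln m%:R - (ln 2 + ln rho).
  by rewrite ln_div ?posrE ?mulr_gt0// lnM ?posrE.
have -> : m%:R / (2 * rho) = 2^-1 * (m%:R / rho) by rewrite invfM mulrCA.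
lra.
Qed.

Local Notation MI :=
  (mutual_information mu nu (fun x y => pX x * pYX x y) pX pY).

Let deficit := (\int[(mu \x nu)%E]_z
  ((log_deficit z)%:E * (pX z.1 * pYX z.1 z.2)%:E))%E.

Let mpXYX : measurable_fun setT (fun z : TX * TY => (pX z.1 * pYX z.1 z.2)%:E).
Proof.
by apply/measurable_EFinP; apply: measurable_funM => //; exact: measurableT_comp.
Qed.

Let mdeficit : measurable_fun setT
  (fun z : TX * TY => ((log_deficit z)%:E * (pX z.1 * pYX z.1 z.2)%:E))%E.
Proof.
by apply: emeasurable_funM => //; apply/measurable_EFinP; exact: measurable_log_deficit.
Qed.

Let deficit_term_ge0 z : (0 <= (log_deficit z)%:E * (pX z.1 * pYX z.1 z.2)%:E)%E.
Proof. by rewrite mule_ge0 ?lee_fin ?log_deficit_ge0// mulr_ge0. Qed.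

Let deficit_ge0 : (0 <= deficit)%E.
Proof. exact: integral_ge0. Qed.

(* Gibbs' inequality in disguise: it makes the mutual information nonnegative. *)
Lemma deficit_le : (deficit <= (ln omega)%:E)%E.
Proof.
have lomega : 0 <= ln omega by exact: ln_ge0.
(* The added 1 is the mass of the joint density on the left and of the product density on the right.
   What remains is pointwise: (1 - ln rho) pYX <= pY, that is ln (1/rho) <= 1/rho - 1. *)
have : (deficit + 1 <= (ln omega)%:E + 1)%E.
  rewrite -{1}integral_joint_density -integral_product_density.
  rewrite -{1}[(ln omega)%:E]mule1 -integral_joint_density -ge0_integralZl ?lee_fin//; last first.
    by move=> z _; rewrite lee_fin mulr_ge0.
  have mp : measurable_fun setT (fun z : TX * TY => (pX z.1 * pY z.2)%:E).
    by apply/measurable_EFinP; apply: measurable_funM; exact: measurableT_comp.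
  have pge0 (z : TX * TY) : (0 <= (pX z.1 * pYX z.1 z.2)%:E)%E by rewrite lee_fin mulr_ge0.
  rewrite /deficit -!ge0_integralD//; first last.
  - by move=> z _; rewrite lee_fin mulr_ge0.
  - exact: emeasurable_funM.
  - by move=> z _; rewrite mule_ge0 ?pge0// lee_fin.
  apply: ge0_le_integral => //.
  - by move=> z _; rewrite adde_ge0.
  - exact: emeasurable_funD.
  - by apply: emeasurable_funD => //; exact: emeasurable_funM.
  move=> z _; rewrite -!EFinM -!EFinD lee_fin /log_deficit.
  set rho := _ / pY _.
  suff : (1 - ln rho) * pYX z.1 z.2 <= pY z.2.
    move=> /(ler_wpM2l (pX_ge0 z.1)); lra.
  have [yx0|yx0] := eqVneq (pYX z.1 z.2) 0; first by rewrite yx0 mulr0.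
  have y0 : pY z.2 != 0 by apply: contra_neq yx0 => /pYX_eq0.
  have y1 : 0 < pY z.2 by rewrite lt_neqAle eq_sym y0 pY_ge0.
  have yx1 : 0 < pYX z.1 z.2 by rewrite lt_neqAle eq_sym yx0 pYX_ge0.
  have := ln_le_subr1 (divr_gt0 y1 yx1).
  rewrite /rho !ln_div ?posrE// => h.
  rewrite -ler_pdivlMr//; lra.
by rewrite leeD2rE.
Qed.

Let deficit_fin : deficit \is a fin_num.
Proof. by rewrite ge0_fin_numE// (le_lt_trans deficit_le)// ltry. Qed.

(** In particular the mutual information is finite, so [fine MI] loses nothing. *)
Lemma mutual_informationE : MI = ((ln omega - fine deficit) / ln 2)%:E.
Proof.
have ijoint : (mu \x nu)%E.-integrable setT (fun z : TX * TY => (pX z.1 * pYX z.1 z.2)%:E).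
  apply/integrableP; split => //.
  under eq_integral => z _ do rewrite gee0_abs ?lee_fin ?mulr_ge0//.
  by rewrite integral_joint_density ltry.
have ideficit : (mu \x nu)%E.-integrable setT
    (fun z : TX * TY => ((log_deficit z)%:E * (pX z.1 * pYX z.1 z.2)%:E))%E.
  apply/integrableP; split => //.
  under eq_integral => z _ do rewrite gee0_abs//.
  by rewrite -ge0_fin_numE.
rewrite /mutual_information.
rewrite (eq_integral (fun z => ((ln 2)^-1)%:E * ((ln omega)%:E * (pX z.1 * pYX z.1 z.2)%:E -
   (log_deficit z)%:E * (pX z.1 * pYX z.1 z.2)%:E)))%E; last first.
  move=> z _; rewrite -!EFinM; congr EFin.
  rewrite /log_deficit /log2.
  (* The factor [pX] cannot be cancelled in the ratio where it vanishes, but there it annihilates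
     the integrand. *)
  have [x0|x0] := eqVneq (pX z.1) 0; first by rewrite x0 !(mul0r, mulr0) subrr mulr0.
  by rewrite -mulf_div divff// mul1r; ring.
have iomega := integrableZl measurableT (ln omega) ijoint.
rewrite integralZl//; last exact: integrableB.
rewrite integralB// integralZl// integral_joint_density mule1 -/deficit.
by rewrite -(fineK deficit_fin) -EFinB -EFinM mulrC.
Qed.

(** * Expected logarithms and total cost *)

Let rank w := group_rank n (selected w).+1 (U ^~ w).

Lemma measurable_rank : measurable_fun setT rank.
Proof.
pose f k w : \bar R := (1 + \sum_(i <- others k) (U i w < U k w)%R%:R%:E)%E.
have f0 k w : (0 <= f k w)%E by rewrite adde_ge0// sume_ge0.
have mf k : measurable_fun setT (f k).
  apply: emeasurable_funD => //; apply: emeasurable_sum => i.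
  by apply: measurable_natr_bool; exact: measurable_fun_ltr.
apply: (@measurable_natr _ _ R); apply/measurable_EFinP.
rewrite (_ : _ \o _ = fun w => f (selected w) w).
  exact: (measurable_random_index measurable_selected f0 mf).
by apply/funext => w; rewrite /= /rank group_rankE// EFinD -sumEFin /f big_filter.
Qed.

(** Integrating the pointwise tangent bound [ln_rank_le] replaces an appeal to Jensen's inequality;
    ln omega minus the deficit is the mutual information in nats. *)
Lemma integral_log2_rank_le :
  (\int[P]_w (log2 (rank w)%:R)%:E <= (fine MI + 1)%:E)%E.
Proof.
have rank_gt0 w : (0 < rank w)%N by [].
have lrank_ge0 w : 0 <= ln (rank w)%:R :> R by rewrite ln_ge0// ler1n.
have mXY (f : TX * TY -> R) : measurable_fun setT f -> (forall z, 0 <= f z) ->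
    measurable_fun setT (fun w => f (X w, Y (selected w) w)).
  move=> mf f0; apply/measurable_EFinP.
  apply: (measurable_random_index (f := fun k w => (f (X w, Y k w))%:E) measurable_selected).
    by move=> k w; rewrite lee_fin.
  move=> k; apply/measurable_EFinP; apply: (measurableT_comp mf).
  exact/measurable_fun_pair.
have mlrank : measurable_fun setT (fun w => (ln (rank w)%:R : R)%:E).
  by apply/measurable_EFinP; exact: (measurableT_comp (f := fun m => ln m%:R : R) _ measurable_rank).
have mrank : measurable_fun setT (fun w => (rank w)%:R : R).
  exact: (measurableT_comp (f := fun m => m%:R : R) _ measurable_rank).
have mdef : measurable_fun setT (fun w => (log_deficit (X w, Y (selected w) w))%:E).
  by apply/measurable_EFinP; exact: mXY measurable_log_deficit log_deficit_ge0.
have mweight : measurable_fun setT (fun w => ((rank w)%:R * rank_weight (X w, Y (selected w) w))%:E).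
  by apply/measurable_EFinP; apply: measurable_funM => //; exact: mXY measurable_rank_weight rank_weight_ge0.
(* The deficit stays on the left, among nonnegative terms, until the expectation of ln rank is known
   to be finite. *)
have bound : (\int[P]_w (ln (rank w)%:R)%:E + deficit + 1 <= (ln omega + ln 2 + 1)%:E)%E.
  rewrite /deficit -integral_selected_pair; first last.
  - by rewrite -ge0_fin_numE.
  - by move=> z; rewrite lee_fin log_deficit_ge0.
  - by apply/measurable_EFinP; exact: measurable_log_deficit.
  rewrite -ge0_integralD//; first last.
  - by move=> w _; rewrite lee_fin log_deficit_ge0.
  - by move=> w _; rewrite lee_fin.
  rewrite -(probability_setT P) -[P setT]mul1e -integral_cst// -ge0_integralD//; first last.
  - exact: emeasurable_funD.
  - by move=> w _; rewrite adde_ge0 ?lee_fin ?lrank_ge0 ?log_deficit_ge0.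
  apply: (@le_trans _ _ (\int[P]_w ((ln omega + ln 2)%:E +
      2^-1%:E * ((rank w)%:R * rank_weight (X w, Y (selected w) w))%:E))%E).
    apply: ge0_le_integral => //.
    - by move=> w _; rewrite !adde_ge0 ?lee_fin ?lrank_ge0 ?log_deficit_ge0.
    - by apply: emeasurable_funD => //; exact: emeasurable_funD.
    - by apply: emeasurable_funD => //; exact: emeasurable_funM.
    - by move=> w _; rewrite -EFinM -!EFinD lee_fin; exact: ln_rank_le.
  have l0 : 0 <= ln omega + ln 2 by rewrite addr_ge0// ln_ge0// ler1n.
  have w0 w : 0 <= (rank w)%:R * rank_weight (X w, Y (selected w) w).
    by rewrite mulr_ge0// rank_weight_ge0.
  rewrite ge0_integralD//; first last.
  - exact: emeasurable_funM.
  - by move=> w _; rewrite mule_ge0 ?lee_fin.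
  rewrite integral_cst//= probability_setT mule1 [leRHS]EFinD leeD2l//.
  rewrite ge0_integralZl//; first last.
  - by move=> w _; rewrite lee_fin.
  apply: (@le_trans _ _ (2^-1%:E * 2%:E)%E); last by rewrite -EFinM mulVf.
  rewrite lee_wpmul2l// integral_rank_weight//.
  - exact: measurable_rank_weight.
  - exact: rank_weight_ge0.
  - exact: rank_weight_pYX.
rewrite (eq_integral (fun w => (ln 2)^-1%:E * (ln (rank w)%:R)%:E)%E); last first.
  by move=> w _; rewrite -EFinM mulrC.
rewrite ge0_integralZl//; first last.
- by rewrite lee_fin invr_ge0 ltW// ln2_gt0.
- by move=> w _; rewrite lee_fin.
rewrite mutual_informationE /=.
set A := (\int[P]_w _)%E in bound *.
have A0 : (0 <= A)%E by apply: integral_ge0 => w _; rewrite lee_fin.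
have Afin : A \is a fin_num.
  rewrite ge0_fin_numE//; apply: le_lt_trans (ltry (ln omega + ln 2 + 1)).
  by apply: le_trans bound; rewrite -addeA leeDl// adde_ge0.
move: bound; rewrite -(fineK Afin) -(fineK deficit_fin) -!EFinD -EFinM !lee_fin => bound.
rewrite mulrC ler_pdivrMr ?ln2_gt0// mulrDl divfK ?gt_eqF ?ln2_gt0// mul1r.
lra.
Qed.

Lemma fine_mutual_information_ge0 : 0 <= fine MI.
Proof.
rewrite mutual_informationE /= divr_ge0 ?(ltW (ln2_gt0 R))// subr_ge0.
by rewrite -lee_fin fineK// deficit_le.
Qed.

Lemma integral_log2_group_le :
  (\int[P]_w (log2 (group_index n (selected w).+1)%:R)%:E <= 1)%E.
Proof.
apply: le_trans integral_selected_div_le; apply: ge0_le_integral => //.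
- by move=> w _; rewrite lee_fin log2_ge0// ler1n group_indexS.
- apply/measurable_EFinP.
  exact: (measurableT_comp (f := fun k => log2 (group_index n k.+1)%:R : R) _ measurable_selected).
- apply/measurable_EFinP.
  exact: (measurableT_comp (f := fun k => (k %/ n)%:R : R) _ measurable_selected).
- by move=> w _; rewrite lee_fin group_indexS// log2_nat_le.
Qed.

Lemma sorting_cost_le :
  (sorting_cost P pYX pY omega X (fun i => U i) (fun i => Y i)
     <= MI + (log2 (fine MI + 1))%:E + 9%:E)%E.
Proof.
have log2_2 : log2 2 = 1 :> R by rewrite -[2]expr1 log2_pow2.
have MI0 := fine_mutual_information_ge0.
have MIE : MI = (fine MI)%:E by rewrite mutual_informationE.
rewrite /sorting_cost -/n.
set L := fun w => group_index _ _; set Khat := fun w => group_rank _ _ _.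
have costL : (coding_cost P L <= 4%:E)%E.
  have mL : measurable_fun setT L.
    exact: (measurableT_comp (f := fun k => group_index n k.+1) _ measurable_selected).
  have L_gt0 w : (0 < L w)%N by rewrite /L group_indexS.
  apply: le_trans (coding_cost_le mL L_gt0 ler01 integral_log2_group_le) _.
  by rewrite lee_fin -[1 + 1]/2 log2_2; lra.
have costK : (coding_cost P Khat <= (fine MI + 1 + log2 (fine MI + 1 + 1) + 2)%:E)%E.
  apply: coding_cost_le => //.
  - exact: measurable_rank.
  - by rewrite addr_ge0.
  - exact: integral_log2_rank_le.
apply: (le_trans (leeD costL costK)); rewrite MIE -!EFinD lee_fin.
(* I + 2 <= 2 (I + 1) exchanges the shift inside the logarithm for one bit. *)
have : log2 (fine MI + 1 + 1) <= log2 (2 * (fine MI + 1)) :> R.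
  by apply: le_log2; lra.
rewrite log2M//; last by lra.
rewrite log2_2; lra.
Qed.

End sampler.

Unset Implicit Arguments.
Set Strict Implicit.

Theorem proposition4p1 (R : realType) (d dX dY : measure_display)
    (Omega : measurableType d) (TX : measurableType dX)
    (TY : measurableType dY) (P : probability Omega R)
    (mu : {sigma_finite_measure set TX -> \bar R})
    (nu : {sigma_finite_measure set TY -> \bar R})
    (pX : TX -> R) (pYX : TX -> TY -> R) (pY : TY -> R) (omega : R)
    (X : {RV P >-> TX}) (U : nat -> {RV P >-> R}) (Y : nat -> {RV P >-> TY})
    (pX_density : is_density mu pX)
    (pYX_density : is_conditional_density nu pYX)
    (pY_density : is_output_density mu nu pX pYX pY)
    (omega_ge1 : 1 <= omega)
    (bounding : bounding_condition pYX pY omega)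
    (X_law : has_law mu X pX)
    (U_law : forall i A, measurable A ->
       distribution P (U i) A = uniform_prob (@ltr01 R) A)
    (Y_law : forall i, has_law nu (Y i) pY)
    (indep : mutually_independent P (sampler_sigma X (fun i => U i) (fun i => Y i))) :
  let MI := mutual_information mu nu (fun x y => pX x * pYX x y) pX pY in
  (sorting_cost P pYX pY omega X (fun i => U i) (fun i => Y i)
     <= MI + (log2 (fine MI + 1))%:E + 9%:E)%E.
Proof.
have [density_pY _] := pY_density.
exact: (sorting_cost_le pX_density pYX_density density_pY omega_ge1 bounding X_law U_law Y_law indep).
Qed.
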